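(* Let $\mu,\nu,k$ be integers with $0\le k\le\mu<\nu$. The map $\mathcal{T}^\nu_{\mu,k}:B(\mathcal{H}_\mu)\to B(\mathcal{H}_{\mu+\nu-2k})$, $\mathcal{T}^\nu_{\mu,k}(A)=P_k(A\otimes I)P_k^*$, is completely positive, and the map $\widehat{\mathcal{T}}^\nu_{\mu,k}(A)=\frac{\mu+1}{\mu+\nu-2k+1}P_k(A\otimes I)P_k^*$ is completely positive and trace-preserving.
   Context: For an integer $\tau\ge0$, $\mathcal{H}_\tau$ is the $(\tau+1)$-dimensional space of polynomials in one complex variable of degree $\le\tau$, with inner product $\langle f,g\rangle=\int_{\mathbb{C}}f\overline{g}\,d\iota_\tau$, $d\iota_\tau(z)=\frac{\tau+1}{(1+|z|^2)^\tau}\frac{dA(z)}{\pi(1+|z|^2)^2}$ ($dA$ Lebesgue measure). $SU(2)$ acts unitarily and irreducibly on $\mathcal{H}_\tau$ by $(g\cdot f)(z)=(-\overline{b}z+\overline{a})^\tau f\big(\frac{az+b}{-\overline{b}z+\overline{a}}\big)$ where $g^{-1}=\begin{pmatrix}a&b\\-\overline b&\overline a\end{pmatrix}$. $\mathcal{H}_\mu\otimes\mathcal{H}_\nu$ is realized as polynomials $F(z,w)$ of degree $\le\mu$ in $z$, $\le\nu$ in $w$, with the inner product of $L^2(d\iota_\mu(z)d\iota_\nu(w))$; $I$ is the identity on $\mathcal{H}_\nu$. Define $J_k:\mathcal{H}_\mu\otimes\mathcal{H}_\nu\to\mathcal{H}_{\mu+\nu-2k}$ by $J_k(F)(\xi)=\int_{\mathbb{C}^2}F(z,w)(\overline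 z-\overline w)^k(1+\xi\overline z)^{\mu-k}(1+\xi\overline w)^{\nu-k}d\iota_\mu(z)d\iota_\nu(w)$, let $C_{\mu,\nu,k}>0$ be given by $C_{\mu,\nu,k}^2=\frac{(-\nu)_k(-\mu)_k}{k!(\mu+\nu-2k+2)_k}$ (rising Pochhammer symbols $(a)_n=a(a+1)\cdots(a+n-1)$), and $P_k:=C_{\mu,\nu,k}J_k$; $P_k$ is the $SU(2)$-equivariant coisometry onto the component $\mathcal{H}_{\mu+\nu-2k}$ in $\mathcal{H}_\mu\otimes\mathcal{H}_\nu\cong\bigoplus_{j=0}^\mu\mathcal{H}_{\mu+\nu-2j}$. *)

(* Defs.v *)
From HB Require Import structures.
From mathcomp Require Import all_boot all_order all_algebra.
From mathcomp Require Import all_classical all_reals all_analysis.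
From mathcomp.real_closed Require Import complex.

Set Implicit Arguments.
Unset Strict Implicit.
Unset Printing Implicit Defensive.

Import Order.TTheory GRing.Theory Num.Theory.
Local Open Scope ring_scope.
Local Open Scope complex_scope.

Section Defs.
Variable R : realType.

(* the complex plane C = R[i], identified with R * R for Lebesgue measure *)
Definition cplx (p : R * R) : R[i] := p.1 +i* p.2.

Notation leb2 := (@lebesgue_measure R \x @lebesgue_measure R)%E.
Notation leb4 := (((@lebesgue_measure R \x @lebesgue_measure R)
                    \x @lebesgue_measure R) \x @lebesgue_measure R)%E.
(* a point q = (((x1, y1), x2), y2) of R^4 encodes (z, w) = (x1 + i y1, x2 + i y2) *)
Definition cz (q : ((R * R) * R) * R) : R[i] := q.1.1.1 +i* q.1.1.2.
Definition cw (q : ((R * R) * R) * R) : R[i] := q.1.2 +i* q.2.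

Definition cintegral d (T : measurableType d) (mu : {measure set T -> \bar R})
  (h : T -> R[i]) : R[i] :=
  (Rintegral mu setT (fun x => complex.Re (h x))) +i* (Rintegral mu setT (fun x => complex.Im (h x))).

Definition nsq (z : R[i]) : R := complex.Re z ^+ 2 + complex.Im z ^+ 2.

(* density of d iota_tau with respect to dA:
   (tau+1)/(1+|z|^2)^tau * 1/(pi (1+|z|^2)^2) *)
Definition dens (tau : nat) (z : R[i]) : R :=
  (tau.+1%:R / (1 + nsq z) ^+ tau) * (1 / (pi * (1 + nsq z) ^+ 2)).

Definition Hsp (tau : nat) : set (R[i] -> R[i]) :=
  [set f | exists c : 'I_tau.+1 -> R[i], forall z, f z = \sum_(i < tau.+1) c i * z ^+ i].

(* H_mu (x) H_nu : polynomials F(z,w) of degree <= mu in z, <= nu in w *)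
Definition Hsp2 (mu nu : nat) : set (R[i] -> R[i] -> R[i]) :=
  [set F | exists c : 'I_mu.+1 -> 'I_nu.+1 -> R[i], forall z w,
      F z w = \sum_(i < mu.+1) \sum_(j < nu.+1) c i j * z ^+ i * w ^+ j].

Definition ip (tau : nat) (f g : R[i] -> R[i]) : R[i] :=
  cintegral leb2 (fun p => let z := cplx p in f z * conjc (g z) * (dens tau z)%:C).

Definition ip2 (mu nu : nat) (F G : R[i] -> R[i] -> R[i]) : R[i] :=
  cintegral leb4 (fun q => let z := cz q in let w := cw q in
    F z w * conjc (G z w) * (dens mu z * dens nu w)%:C).

(* operators: A in B(H_tau) means A maps H_tau into itself and is C-linear there *)
Definition op := (R[i] -> R[i]) -> (R[i] -> R[i]).

Definition isop (tau : nat) (A : op) : Prop :=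
  (forall f, Hsp tau f -> Hsp tau (A f)) /\
  (forall (a : R[i]) f g, Hsp tau f -> Hsp tau g ->
     A (fun z => a * f z + g z) = (fun z => a * A f z + A g z)).

Definition tensorI (A : op) (F : R[i] -> R[i] -> R[i]) : R[i] -> R[i] -> R[i] :=
  fun z w => A (fun z' => F z' w) z.

Definition poch (a : R) (n : nat) : R := \prod_(i < n) (a + i%:R).

Definition Cconst (mu nu k : nat) : R :=
  Num.sqrt (poch (- nu%:R) k * poch (- mu%:R) k /
            (k`!%:R * poch ((mu + nu - 2 * k)%N%:R + 2) k)).

Definition Jk (mu nu k : nat) (F : R[i] -> R[i] -> R[i]) : R[i] -> R[i] :=
  fun xi => cintegral leb4 (fun q => let z := cz q in let w := cw q in
    F z w * (conjc z - conjc w) ^+ k * (1 + xi * conjc z) ^+ (mu - k)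
      * (1 + xi * conjc w) ^+ (nu - k) * (dens mu z * dens nu w)%:C).

Definition Pk (mu nu k : nat) (F : R[i] -> R[i] -> R[i]) : R[i] -> R[i] :=
  fun xi => (Cconst mu nu k)%:C * Jk mu nu k F xi.

Definition is_adjoint (mu nu n : nat)
  (P : (R[i] -> R[i] -> R[i]) -> (R[i] -> R[i]))
  (Pstar : (R[i] -> R[i]) -> (R[i] -> R[i] -> R[i])) : Prop :=
  (forall g, Hsp n g -> Hsp2 mu nu (Pstar g)) /\
  (forall F g, Hsp2 mu nu F -> Hsp n g -> ip n (P F) g = ip2 mu nu F (Pstar g)).

Definition coefs (tau : nat) (f : R[i] -> R[i]) : {ffun 'I_tau.+1 -> R[i]} :=
  xget [ffun => 0] [set c : {ffun 'I_tau.+1 -> R[i]} |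
                    forall z, f z = \sum_(i < tau.+1) c i * z ^+ i].

(* trace of an operator on H_tau (basis independent; computed in the monomial basis) *)
Definition optr (tau : nat) (A : op) : R[i] :=
  \sum_(i < tau.+1) coefs tau (A (fun z => z ^+ i)) i.

(* positivity of the block operator [A_ij] on H_tau^N = C^N (x) H_tau *)
Definition blockpos (tau N : nat) (A : 'I_N -> 'I_N -> op) : Prop :=
  forall f : 'I_N -> (R[i] -> R[i]), (forall i, Hsp tau (f i)) ->
    0 <= \sum_(i < N) \sum_(j < N) ip tau (A i j (f j)) (f i).

Definition completely_positive (m n : nat) (T : op -> op) : Prop :=
  (forall A, isop m A -> isop n (T A)) /\
  (forall (N : nat) (A : 'I_N -> 'I_N -> op),
     (forall i j, isop m (A i j)) -> blockpos m A -> blockpos n (fun i j => T (A i j))).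

Definition trace_preserving (m n : nat) (T : op -> op) : Prop :=
  forall A, isop m A -> optr n (T A) = optr m A.

End Defs.

(* Main.v *)
Require Import Defs.
From HB Require Import structures.
From mathcomp Require Import all_boot all_order all_algebra.
From mathcomp Require Import all_classical all_reals all_analysis.
From mathcomp.real_closed Require Import complex.
From mathcomp Require Import measurable_realfun ring lra zify.

(** In the monomial bases everything is a finite computation once the moments
    of [d iota_tau] are known.  Writing m(i, j, N) for the integral of
    z^i conj(z)^j / (1 + |z|^2)^N, Stokes' theorem gives
      N m(i, j + 1, N + 1) = i m(i - 1, j, N)
    and its conjugate, which forces the orthogonality of the monomials and,
    starting from the integral of (1 + |z|^2)^-2, the value
    |z^i|^2 = 1 / binomial(tau, i).

    Writing P^* f = sum_l (V_l f)(z) w^l, orthogonality of the w^l gives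
      <P (A (x) I) P^* g, f> = sum_l <A V_l g, V_l f> / binomial(nu, l),
    a Kraus decomposition; this holds for any P that has an adjoint.

    J_k is pairing with (z - w)^k (1 + xi z)^(mu - k) (1 + xi w)^(nu - k), so
    P_k maps z^i w^j to a multiple [proj_coef i j] of xi^(i + j - k), and P_k^*
    maps xi^m to the sum of [adj_coef i j] z^i w^j over i + j = m + k.  Trace
    preservation says that S_i = sum_j proj_coef i j * adj_coef i j equals
    (n + 1) / (mu + 1) for all i: the translation invariance of the kernel gives
    S_(i + 1) = S_i (this replaces Schur's lemma), and S_0 is a Vandermonde-type
    sum of binomial coefficients. *)

Set Implicit Arguments.
Unset Strict Implicit.
Unset Printing Implicit Defensive.

Import Order.TTheory GRing.Theory Num.Theory.
Import numFieldNormedType.Exports.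
Local Open Scope ring_scope.
Local Open Scope complex_scope.
Local Open Scope classical_set_scope.

Local Notation leb R := (@lebesgue_measure R).
Local Notation leb2 R := (leb R \x leb R)%E.
Local Notation leb4 R := (((leb R \x leb R) \x leb R) \x leb R)%E.

(** * Calculus on the real line *)

Section RealLine.
Context {R : realType}.
Implicit Types (f g F : R -> R) (x r l df dg : R).

Lemma is_derive1M f g x df dg : is_derive x 1 f df -> is_derive x 1 g dg ->
  is_derive x 1 (fun t => f t * g t) (df * g x + f x * dg).
Proof.
move=> hf hg; apply: is_derive_eq; rewrite addrC /GRing.scale /= mulrC.
by congr (_ + _); rewrite mulrC.
Qed.

Lemma is_derive1V f x df : f x != 0 -> is_derive x 1 f df ->
  is_derive x 1 (fun t => (f t)^-1) (- df / f x ^+ 2).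
Proof.
move=> fx hf; apply: (is_derive_eq (is_deriveV fx hf)).
by rewrite /GRing.scale /= !mulNr mulrC.
Qed.

Lemma is_derive1X f n x df : is_derive x 1 f df ->
  is_derive x 1 (fun t => f t ^+ n) (n%:R * f x ^+ n.-1 * df).
Proof. by move=> hf; rewrite -exprfctE; exact: is_deriveX. Qed.

Lemma is_derive1_addsqr r x : is_derive x 1 (fun t => r + t ^+ 2) (2 * x).
Proof.
apply: (is_derive_eq
  (is_deriveD (is_derive_cst r x 1) (is_derive1X 2 (is_derive_id x 1)))).
by rewrite add0r mulr1.
Qed.

Lemma is_derive1_continuous F f :
  (forall x, is_derive x 1 F (f x)) -> continuous F.
Proof.
move=> dF x; apply: differentiable_continuous; apply/derivable1_diffP.
by have [] := dF x.
Qed.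

Lemma cvgy_le_inv f :
  (forall x, 1 <= x -> `|f x| <= x^-1) -> f x @[x --> +oo] --> 0.
Proof.
move=> fx; apply/cvgrPdist_le => e e0; near=> x.
have x1 : 1 <= x by near: x; apply: nbhs_pinfty_ge; exact: num_real.
have xe : e^-1 <= x by near: x; apply: nbhs_pinfty_ge; exact: num_real.
rewrite sub0r normrN; apply: (le_trans (fx x x1)).
by rewrite invf_ple ?posrE// (lt_le_trans _ x1).
Unshelve. all: end_near. Qed.

Lemma integralT_even_FTC f F l :
  (forall x, 0 <= f x) -> continuous f -> (forall x, f (- x) = f x) ->
  (forall x, is_derive x 1 F (f x)) -> F 0 = 0 -> F x @[x --> +oo] --> l ->
  (\int[leb R]_x (f x)%:E = (2 * l)%:E)%E.
Proof.
move=> f0 cf fe dF F0 Fl; have cF := is_derive1_continuous dF.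
rewrite ge0_symfun_integralT//; last by move=> x /=; rewrite fe.
rewrite (_ : [set x | _] = `[0, +oo[%classic); last first.
  by apply/seteqP; split => x/=; rewrite in_itv/= andbT.
rewrite (@ge0_continuous_FTC2y _ f F 0 l)//.
- by rewrite F0 sube0 -EFinM.
- exact: continuous_subspaceT.
- exact/cvg_at_right_filter/cF.
- by move=> x _; rewrite derive1E; apply: derive_val.
Qed.

Lemma cvg_integral_itvNn f : (leb R).-integrable setT (EFin \o f) ->
  (\int[leb R]_(x in `[(- n.+1%:R)%R, n.+1%:R%R]) (f x)%:E @[n --> \oo] -->
   \int[leb R]_x (f x)%:E)%E.
Proof.
move=> intf; pose D n : set R := `[- n.+1%:R, n.+1%:R]%classic.
pose fn n : R -> \bar R := (EFin \o f) \_ (D n).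
have mf : measurable_fun setT (EFin \o f) := measurable_int _ intf.
have mfn n : measurable_fun setT (fn n).
  apply/(measurable_restrictT _ _).1; first exact: measurable_itv.
  exact: measurable_funTS.
have fnf : {ae (leb R), forall x, setT x -> fn ^~ x @ \oo --> (EFin \o f) x}.
  apply: aeW => x _; apply: cvg_near_cst.
  exists (Num.truncn `|x|) => // n /= xn; rewrite /fn patchE mem_set//.
  rewrite /D/= in_itv/= -ler_norml ltW// (lt_le_trans (truncnS_gt _))//.
  by rewrite ler_nat.
have fn_le : {ae (leb R), forall x n, setT x -> (`|fn n x| <= `|(f x)%:E|)%E}.
  apply: aeW => x n _; rewrite /fn patchE; case: ifPn => //= _.
  by rewrite normr0 lee_fin.
have [_ _ /=] := @dominated_convergence _ _ _ (leb R) _ measurableT _ _ _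
  mfn mf fnf (integrable_abse intf) fn_le.
by under eq_fun do rewrite -integral_mkcond.
Qed.

Lemma integralT_FTC f F (l l' : R) :
  (leb R).-integrable setT (EFin \o f) -> continuous f ->
  (forall x, is_derive x 1 F (f x)) ->
  F x @[x --> +oo] --> l -> F x @[x --> -oo] --> l' ->
  (\int[leb R]_x (f x)%:E = (l - l')%:E)%E.
Proof.
move=> intf cf dF Fl Fl'; have cF := is_derive1_continuous dF.
apply: cvg_unique (cvg_integral_itvNn intf) _ => //.
have FTC n : (\int[leb R]_(x in `[(- n.+1%:R)%R, n.+1%:R%R]) (f x)%:E =
              (F n.+1%:R - F (- n.+1%:R))%:E)%E.
  rewrite (@continuous_FTC2 _ f F) ?EFinB ?gtrN//.
  - exact: continuous_subspaceT.
  - split; first by move=> x _; have [] := dF x.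
      exact/cvg_at_right_filter/cF.
    exact/cvg_at_left_filter/cF.
  - by move=> x _; rewrite derive1E; apply: derive_val.
rewrite /=; under eq_fun do rewrite FTC.
apply: cvg_EFin; first by near=> n.
have cvgSn : (n.+1%:R : R) @[n --> \oo] --> +oo.
  by have := @cvgr_idn R; rewrite -(cvg_shiftS (fun n => n%:R : R)).
apply: cvgB; first exact: (cvg_comp _ _ cvgSn Fl).
by apply: (cvg_comp _ (F \o -%R) cvgSn); exact/cvgNy_compNP.
Unshelve. all: end_near. Qed.

End RealLine.

Section ExplicitIntegrals.
Context {R : realType}.
Implicit Types (x r : R).

Lemma integralT_oneDsqrV : (\int[leb R]_x ((1 + x ^+ 2)^-1)%:E = pi%:E)%E.
Proof.
rewrite (@integralT_even_FTC _ _ atan (pi / 2)).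
- by congr _%:E; field.
- by move=> x; rewrite invr_ge0 addr_ge0 ?sqr_ge0.
- exact: continuous_oneDsqrV.
- by move=> x; rewrite sqrrN.
- exact: atan0.
- exact: cvgy_atan.
Qed.

Lemma integralT_sqr_addsqrV r : 0 < r ->
  (\int[leb R]_x (((r ^+ 2 + x ^+ 2) ^+ 2)^-1)%:E = (pi / (2 * r ^+ 3))%:E)%E.
Proof.
move=> r0; have rN0 : r != 0 by rewrite gt_eqF.
have DN0 x : r ^+ 2 + x ^+ 2 != 0.
  by rewrite gt_eqF// ltr_pwDl ?exprn_gt0 ?sqr_ge0.
have dD x := is_derive1_addsqr (r ^+ 2) x.
pose F x := (2 * r ^+ 2)^-1 * (x * (r ^+ 2 + x ^+ 2)^-1)
          + (2 * r ^+ 3)^-1 * atan (x * r^-1).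
have dF x : is_derive x 1 F ((r ^+ 2 + x ^+ 2) ^+ 2)^-1.
  have dl := is_derive1M (is_derive_id x 1)
    (is_derive1V (f := fun t => r ^+ 2 + t ^+ 2) (DN0 x) (dD x)).
  have dr := @is_derive1_comp _ atan _ x _ _ (is_derive1_atan (x * r^-1))
    (is_derive1M (is_derive_id x 1) (is_derive_cst r^-1 x 1)).
  apply: (is_derive_eq (is_deriveD (is_deriveZ (2 * r ^+ 2)^-1 dl)
    (is_deriveZ (2 * r ^+ 3)^-1 dr))).
  by rewrite /GRing.scale /=; field; rewrite rN0 DN0.
rewrite (@integralT_even_FTC _ _ F (0 + (2 * r ^+ 3)^-1 * (pi / 2)))//.
- by congr _%:E; field.
- by move=> x; rewrite invr_ge0 sqr_ge0.
- apply: is_derive1_continuous => x.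
  by apply: is_derive1V (is_derive1X 2 (dD x)); rewrite expf_neq0.
- by move=> x; rewrite sqrrN.
- by rewrite /F !mul0r atan0 !mulr0 addr0.
- rewrite /F; apply: cvgD.
    rewrite -[X in _ --> X](mulr0 (2 * r ^+ 2)^-1); apply: cvgMr.
    apply: cvgy_le_inv => x x1; have x0 : 0 < x by exact: lt_le_trans x1.
    rewrite ger0_norm; last by rewrite divr_ge0 ?addr_ge0 ?sqr_ge0 ?ltW.
    rewrite ler_pdivrMr ?ltr_pwDl ?exprn_gt0 ?sqr_ge0// mulrC ler_pdivlMr//.
    by rewrite -expr2 lerDr sqr_ge0.
  apply: cvgMr; have xr : x * r^-1 @[x --> +oo] --> +oo.
    by apply: gt0_cvgMly; [rewrite invr_gt0|exact: cvg_id].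
  exact: (cvg_comp _ _ xr (@cvgy_atan R)).
Qed.

Local Notation sqrt1 x := (Num.sqrt (1 + x ^+ 2)).

Lemma sqrt_oneDsqr_gt0 x : 0 < sqrt1 x.
Proof. by rewrite sqrtr_gt0 ltr_pwDl ?sqr_ge0. Qed.

Lemma sqr_sqrt_oneDsqr x : sqrt1 x ^+ 2 = 1 + x ^+ 2.
Proof. by rewrite sqr_sqrtr// addr_ge0 ?sqr_ge0. Qed.

Lemma is_derive1_sqrt_oneDsqr x :
  is_derive x 1 (fun t => sqrt1 t) ((2 * sqrt1 x)^-1 * (2 * x)).
Proof.
apply: (@is_derive1_comp _ Num.sqrt); last exact: is_derive1_addsqr.
by apply: is_derive1_sqrt; rewrite ltr_pwDl ?sqr_ge0.
Qed.

Lemma cvgy_div_sqrt_oneDsqr : x / sqrt1 x @[x --> +oo] --> (1 : R).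
Proof.
apply: (@cvg_zero _ R^o _ _ _ (fun x : R => x / sqrt1 x)).
apply: cvgy_le_inv => x x1; have x0 : 0 < x by exact: lt_le_trans x1.
have := sqrt_oneDsqr_gt0 x; have := sqr_sqrt_oneDsqr x.
move: (sqrt1 x) => s s2 s0; rewrite -[X in `|X|]/(x / s - 1).
have [x_ge0 s_ge0] := (ltW x0, ltW s0).
have xs : x <= s by rewrite -(@ler_pXn2r _ 2) ?nnegrE// s2 lerDr.
have sx1 : s - x <= 1.
  by rewrite lerBlDl -(@ler_pXn2r _ 2) ?nnegrE ?addr_ge0// s2; nra.
rewrite distrC (_ : 1 - x / s = (s - x) / s); last by field; rewrite gt_eqF.
rewrite ger0_norm; last by rewrite divr_ge0 ?subr_ge0.
rewrite -[leRHS]mul1r.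
by rewrite ler_pM ?subr_ge0 ?invr_ge0// lef_pV2 ?posrE.
Qed.

Lemma integralT_sqrt_oneDsqr_cubeV :
  (\int[leb R]_x ((sqrt1 x ^+ 3)^-1)%:E = 2%:E)%E.
Proof.
have sN0 x : sqrt1 x != 0 by rewrite gt_eqF ?sqrt_oneDsqr_gt0.
have dF x : is_derive x 1 (fun x => x / sqrt1 x) (sqrt1 x ^+ 3)^-1.
  apply: (is_derive_eq (is_derive1M (is_derive_id x 1)
    (is_derive1V (f := fun t => sqrt1 t) (sN0 x) (is_derive1_sqrt_oneDsqr x)))).
  transitivity ((sqrt1 x ^+ 2 - x ^+ 2) / sqrt1 x ^+ 3); first by field.
  by rewrite sqr_sqrt_oneDsqr addrK mul1r.
rewrite (@integralT_even_FTC _ _ (fun x => x / sqrt1 x) 1).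
- by rewrite mulr1.
- by move=> x; rewrite invr_ge0 exprn_ge0// ltW ?sqrt_oneDsqr_gt0.
- apply: is_derive1_continuous => x.
  apply: is_derive1V (is_derive1X 3 (is_derive1_sqrt_oneDsqr x)).
  by rewrite expf_neq0.
- by move=> x; rewrite sqrrN.
- by rewrite mul0r.
- exact: cvgy_div_sqrt_oneDsqr.
Qed.

End ExplicitIntegrals.

(** * Integration of real- and complex-valued functions *)

Section HasRealIntegral.
Context d (T : measurableType d) (R : realType).
Variable mu : {measure set T -> \bar R}.
Implicit Types (f g : T -> R) (a b v w : R).

Definition has_Rintegral f v : Prop :=
  mu.-integrable setT (EFin \o f) /\ Rintegral mu setT f = v.

Lemma eq_has_Rintegral f g v : f =1 g -> has_Rintegral f v -> has_Rintegral g v.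
Proof. by move=> /funext->. Qed.

Lemma has_Rintegral_lin a b f g v w : has_Rintegral f v -> has_Rintegral g w ->
  has_Rintegral (fun x => a * f x + b * g x) (a * v + b * w).
Proof.
move=> [fi <-] [gi <-]; have afi := integrableZl measurableT a fi.
have bgi := integrableZl measurableT b gi; split.
  exact: (integrableD measurableT afi bgi).
by rewrite RintegralD// !RintegralZl.
Qed.

Lemma has_Rintegral_funrposneg f v : has_Rintegral f v ->
  exists v1 v2, [/\ has_Rintegral f^\+ v1, has_Rintegral f^\- v2 & v = v1 - v2].
Proof.
move=> [fi <-]; have fp := integrable_funrpos measurableT fi.
have fn := integrable_funrneg measurableT fi.
exists (Rintegral mu setT f^\+), (Rintegral mu setT f^\-); split => //.
by rewrite -RintegralB//; congr Rintegral; exact/esym/funrposBneg.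
Qed.

Lemma ge0_has_Rintegral f v : measurable_fun setT f -> (forall x, 0 <= f x) ->
  (\int[mu]_x (f x)%:E = v%:E)%E -> has_Rintegral f v.
Proof.
move=> mf f0 fv; split; last by rewrite /Rintegral fv.
apply/integrableP; split; first exact/measurable_EFinP.
by under eq_integral do rewrite /= ger0_norm//; rewrite fv ltry.
Qed.

End HasRealIntegral.

(* The canonical sigma-finite structure of the library on [m1 \x m2] is only
   found for subprobabilities; the alias below recovers it for all sigma-finite
   factors. *)
Section SigmaFiniteProduct.
Context d1 d2 (T1 : measurableType d1) (T2 : measurableType d2) (R : realType).
Variables (m1 : {sigma_finite_measure set T1 -> \bar R})
  (m2 : {sigma_finite_measure set T2 -> \bar R}).

Definition sigma_finite_prod : set (T1 * T2) -> \bar R := (m1 \x m2)%E.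
HB.instance Definition _ := Measure.on sigma_finite_prod.

Let sigma_finite_prod_subproof : sigma_finite setT sigma_finite_prod.
Proof.
by have [] := lebesgue_integral_fubini.measure_function_Measure_isSigmaFinite__to__measure_function_isSigmaFinite
    m1 m2.
Qed.

HB.instance Definition _ := @Measure_isSigmaFinite.Build _ _ _
  sigma_finite_prod sigma_finite_prod_subproof.

End SigmaFiniteProduct.

Section Tensor.
Context d1 d2 d3 (T1 : measurableType d1) (T2 : measurableType d2)
  (T3 : measurableType d3) (R : realType).
Variables (m1 : {sigma_finite_measure set T1 -> \bar R})
  (m2 : {sigma_finite_measure set T2 -> \bar R})
  (m3 : {sigma_finite_measure set T3 -> \bar R}).
Local Notation m23 := (m2 \x m3)%E.
Local Notation m123 := ((m1 \x m2) \x m3)%E.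
Implicit Types (phi : T1 -> R) (psi : T2 * T3 -> R).

Definition tensor phi psi (q : (T1 * T2) * T3) : R :=
  phi q.1.1 * psi (q.1.2, q.2).

Lemma measurable_tensor phi psi : measurable_fun setT phi ->
  measurable_fun setT psi -> measurable_fun setT (tensor phi psi).
Proof.
move=> mphi mpsi; apply: measurable_funM.
  apply: (measurableT_comp mphi).
  exact: (measurableT_comp measurable_fst measurable_fst).
apply: (measurableT_comp mpsi); apply/measurable_fun_pairP; split.
  exact: (measurableT_comp measurable_snd measurable_fst).
exact: measurable_snd.
Qed.

Lemma ge0_integral_tensor phi psi : measurable_fun setT phi ->
  measurable_fun setT psi -> (forall x, 0 <= phi x) -> (forall y, 0 <= psi y) ->
  (\int[m123]_q (tensor phi psi q)%:E =
   \int[m1]_x (phi x)%:E * \int[m23]_y (psi y)%:E)%E.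
Proof.
move=> mphi mpsi phi0 psi0.
have /measurable_EFinP mt := measurable_tensor mphi mpsi.
have /measurable_EFinP mpsiE := mpsi; have /measurable_EFinP mphiE := mphi.
have psiE0 y : (0 <= (EFin \o psi) y)%E by rewrite lee_fin.
have t0 q : (0 <= (EFin \o tensor phi psi) q)%E by rewrite lee_fin mulr_ge0.
have mF := @measurable_fun_fubini_tonelli_F _ _ _ _ _ m3 _ mpsiE psiE0.
have F0 x : (0 <= fubini_F m3 (EFin \o psi) x)%E.
  by apply: integral_ge0 => t _; exact: psiE0.
pose G p := ((phi p.1)%:E * fubini_F m3 (EFin \o psi) p.2)%E.
have G0 p : (0 <= G p)%E by rewrite /G mule_ge0// lee_fin.
have mG : measurable_fun setT G.
  apply: emeasurable_funM; first exact: (measurableT_comp mphiE measurable_fst).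
  exact: (measurableT_comp mF measurable_snd).
transitivity (\int[m1 \x m2]_p G p)%E.
  apply: (etrans (@fubini_tonelli1 _ _ (T1 * T2)%type T3 R
    (sigma_finite_prod m1 m2) m3 _ mt t0)).
  apply: eq_integral => p _; rewrite /fubini_F /tensor /G /=.
  under eq_integral do rewrite EFinM.
  rewrite ge0_integralZl_EFin//; first by move=> t _; exact: psiE0.
  exact: (measurableT_comp mpsiE (pair1_measurable p.2)).
apply: (etrans (@fubini_tonelli1 _ _ _ _ R m1 m2 _ mG G0)).
rewrite /fubini_F /G /=.
under eq_integral do rewrite ge0_integralZl_EFin//.
rewrite ge0_integralZr//.
- by congr (_ * _)%E; rewrite fubini_tonelli1.
- by move=> x _; rewrite lee_fin.
- by apply: integral_ge0 => x _; exact: F0.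
Qed.

Lemma ge0_has_Rintegral_tensor phi psi v w :
  (forall x, 0 <= phi x) -> (forall y, 0 <= psi y) ->
  has_Rintegral m1 phi v -> has_Rintegral m23 psi w ->
  has_Rintegral m123 (tensor phi psi) (v * w).
Proof.
move=> phi0 psi0 [iphi <-] [ipsi <-].
have /measurable_EFinP mphi := measurable_int _ iphi.
have /measurable_EFinP mpsi := measurable_int _ ipsi.
apply: ge0_has_Rintegral; first exact: measurable_tensor.
  by move=> q; rewrite mulr_ge0.
rewrite ge0_integral_tensor// EFinM /Rintegral !fineK//.
  exact: (integrable_fin_num measurableT ipsi).
exact: (integrable_fin_num measurableT iphi).
Qed.

Lemma has_Rintegral_tensor phi psi v w :
  has_Rintegral m1 phi v -> has_Rintegral m23 psi w ->
  has_Rintegral m123 (tensor phi psi) (v * w).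
Proof.
move=> /has_Rintegral_funrposneg[v1 [v2 [phip phin ->]]].
move=> /has_Rintegral_funrposneg[w1 [w2 [psip psin ->]]].
have [phip0 phin0] := (funrpos_ge0 phi, funrneg_ge0 phi).
have [psip0 psin0] := (funrpos_ge0 psi, funrneg_ge0 psi).
have pp := ge0_has_Rintegral_tensor phip0 psip0 phip psip.
have pn := ge0_has_Rintegral_tensor phip0 psin0 phip psin.
have np := ge0_has_Rintegral_tensor phin0 psip0 phin psip.
have nn := ge0_has_Rintegral_tensor phin0 psin0 phin psin.
have := has_Rintegral_lin 1 1 (has_Rintegral_lin 1 (-1) pp pn)
  (has_Rintegral_lin (-1) 1 np nn).
rewrite (_ : 1 * _ + _ = (v1 - v2) * (w1 - w2)); last by ring.
apply: eq_has_Rintegral => q; rewrite /tensor.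
rewrite -[in RHS](funrposBneg phi) -[in RHS](funrposBneg psi) !fctE; ring.
Qed.

End Tensor.

Section ComplexParts.
Context {R : realType}.
Implicit Types (x y : R[i]) (r : R).

Lemma cReD x y : complex.Re (x + y) = complex.Re x + complex.Re y.
Proof. by case: x y => a b [c d]. Qed.

Lemma cImD x y : complex.Im (x + y) = complex.Im x + complex.Im y.
Proof. by case: x y => a b [c d]. Qed.

Lemma cReM x y : complex.Re (x * y) =
  complex.Re x * complex.Re y - complex.Im x * complex.Im y.
Proof. by case: x y => a b [c d]. Qed.

Lemma cImM x y : complex.Im (x * y) =
  complex.Re x * complex.Im y + complex.Im x * complex.Re y.
Proof. by case: x y => a b [c d]. Qed.

Lemma cRe_conjc x : complex.Re (conjc x) = complex.Re x.
Proof. by case: x. Qed.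

Lemma cIm_conjc x : complex.Im (conjc x) = - complex.Im x.
Proof. by case: x. Qed.

Lemma complex_ext x y :
  complex.Re x = complex.Re y -> complex.Im x = complex.Im y -> x = y.
Proof. by case: x y => a b [c d] /= -> ->. Qed.

Lemma nsqM x y : nsq (x * y) = nsq x * nsq y.
Proof. by rewrite /nsq cReM cImM; ring. Qed.

Lemma nsqX x n : nsq (x ^+ n) = nsq x ^+ n.
Proof.
elim: n => [|n IHn]; last by rewrite !exprS nsqM IHn.
by rewrite !expr0 /nsq /= expr1n expr0n addr0.
Qed.

Lemma nsq_conjc x : nsq (conjc x) = nsq x.
Proof. by rewrite /nsq cRe_conjc cIm_conjc sqrrN. Qed.

Lemma nsq_real r : nsq r%:C = r ^+ 2.
Proof. by rewrite /nsq /= expr0n addr0. Qed.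

Lemma mulc_conjc x : x * conjc x = (nsq x)%:C.
Proof.
by apply: complex_ext; rewrite ?cReM ?cImM cRe_conjc cIm_conjc /nsq /=; ring.
Qed.

Lemma nsq_ge0 x : 0 <= nsq x.
Proof. by rewrite addr_ge0 ?sqr_ge0. Qed.

Lemma norm_cRe_le x r : 0 <= r -> nsq x <= r ^+ 2 -> `|complex.Re x| <= r.
Proof.
move=> r0 xr; rewrite -(@ler_pXn2r _ 2) ?nnegrE// real_normK ?num_real//.
by apply: le_trans xr; rewrite lerDl sqr_ge0.
Qed.

Lemma norm_cIm_le x r : 0 <= r -> nsq x <= r ^+ 2 -> `|complex.Im x| <= r.
Proof.
move=> r0 xr; rewrite -(@ler_pXn2r _ 2) ?nnegrE// real_normK ?num_real//.
by apply: le_trans xr; rewrite lerDr sqr_ge0.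
Qed.

End ComplexParts.

Section HasComplexIntegral.
Context d (T : measurableType d) {R : realType}.
Variable mu : {measure set T -> \bar R}.
Implicit Types (h : T -> R[i]) (c v : R[i]).

Definition has_cintegral h v : Prop :=
  has_Rintegral mu (fun x => complex.Re (h x)) (complex.Re v) /\
  has_Rintegral mu (fun x => complex.Im (h x)) (complex.Im v).

Lemma has_cintegralE h v : has_cintegral h v -> cintegral mu h = v.
Proof. by move=> [[_ hr] [_ hi]]; rewrite /cintegral hr hi; case: (v). Qed.

Lemma eq_has_cintegral h1 h2 v :
  h1 =1 h2 -> has_cintegral h1 v -> has_cintegral h2 v.
Proof. by move=> /funext->. Qed.

Lemma has_cintegral0 : has_cintegral (fun=> 0) 0.
Proof.
by split; (split; [exact: integrable0|rewrite /Rintegral integral0]).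
Qed.

Lemma has_cintegralD h1 h2 v1 v2 : has_cintegral h1 v1 -> has_cintegral h2 v2 ->
  has_cintegral (fun x => h1 x + h2 x) (v1 + v2).
Proof.
move=> [r1 i1] [r2 i2]; split; rewrite ?cReD ?cImD.
  have := has_Rintegral_lin 1 1 r1 r2; rewrite !mul1r.
  by apply: eq_has_Rintegral => x; rewrite cReD !mul1r.
have := has_Rintegral_lin 1 1 i1 i2; rewrite !mul1r.
by apply: eq_has_Rintegral => x; rewrite cImD !mul1r.
Qed.

Lemma has_cintegralZ c h v : has_cintegral h v ->
  has_cintegral (fun x => c * h x) (c * v).
Proof.
move=> [hr hi]; split; rewrite ?cReM ?cImM.
  have := has_Rintegral_lin (complex.Re c) (- complex.Im c) hr hi.
  by rewrite mulNr; apply: eq_has_Rintegral => x; rewrite cReM mulNr.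
by apply: eq_has_Rintegral (has_Rintegral_lin _ _ hi hr) => x; rewrite cImM.
Qed.

Lemma has_cintegral_conjc h v : has_cintegral h v ->
  has_cintegral (fun x => conjc (h x)) (conjc v).
Proof.
move=> [hr hi]; split.
  by rewrite cRe_conjc; apply: eq_has_Rintegral hr => x; rewrite cRe_conjc.
have := has_Rintegral_lin (-1) 0 hi hi; rewrite cIm_conjc mul0r addr0 mulN1r.
by apply: eq_has_Rintegral => x; rewrite cIm_conjc mul0r addr0 mulN1r.
Qed.

Lemma has_cintegral_sum (I : Type) (s : seq I) (P : pred I) (h : I -> T -> R[i])
    (v : I -> R[i]) : (forall i, P i -> has_cintegral (h i) (v i)) ->
  has_cintegral (fun x => \sum_(i <- s | P i) h i x) (\sum_(i <- s | P i) v i).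
Proof.
move=> hv; elim: s => [|i s IHs].
  rewrite big_nil; apply: eq_has_cintegral has_cintegral0 => x.
  by rewrite big_nil.
rewrite big_cons; case Pi: (P i).
  apply: eq_has_cintegral (has_cintegralD (hv i Pi) IHs) => x.
  by rewrite big_cons Pi.
by apply: eq_has_cintegral IHs => x; rewrite big_cons Pi.
Qed.

End HasComplexIntegral.

Section LebesgueProduct.
Context {R : realType}.

Lemma has_cintegral_leb4M (f g : R * R -> R[i]) v w :
  has_cintegral (leb2 R) f v -> has_cintegral (leb2 R) g w ->
  has_cintegral (leb4 R) (fun q => f q.1.1 * g (q.1.2, q.2)) (v * w).
Proof.
move=> [fr fi] [gr gi].
pose m1 := sigma_finite_prod (leb R) (leb R).
have rr := has_Rintegral_tensor (m1 := m1) fr gr.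
have ri := has_Rintegral_tensor (m1 := m1) fr gi.
have ir := has_Rintegral_tensor (m1 := m1) fi gr.
have ii := has_Rintegral_tensor (m1 := m1) fi gi.
split; rewrite ?cReM ?cImM.
  have := has_Rintegral_lin 1 (-1) rr ii; rewrite mul1r mulN1r.
  by apply: eq_has_Rintegral => q; rewrite cReM mul1r mulN1r.
have := has_Rintegral_lin 1 1 ri ir; rewrite !mul1r.
by apply: eq_has_Rintegral => q; rewrite cImM !mul1r.
Qed.

End LebesgueProduct.

(** * Integration over the plane *)

Section Plane.
Context {R : realType}.
Implicit Types (f g F : R * R -> R) (p : R * R).

Definition oneDnsq p : R := 1 + nsq (cplx p).

Lemma oneDnsq_ge1 p : 1 <= oneDnsq p.
Proof. by rewrite lerDl nsq_ge0. Qed.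

Lemma oneDnsq_gt0 p : 0 < oneDnsq p.
Proof. exact: lt_le_trans (oneDnsq_ge1 p). Qed.

Lemma oneDnsq_neq0 p : oneDnsq p != 0.
Proof. by rewrite gt_eqF ?oneDnsq_gt0. Qed.

Lemma oneDsqr_le_oneDnsq p : 1 + p.1 ^+ 2 <= oneDnsq p.
Proof. by rewrite lerD2l lerDl sqr_ge0. Qed.

Lemma oneDnsq_swap p : oneDnsq (swap_pair p) = oneDnsq p.
Proof. by congr (1 + _); rewrite /nsq /= addrC. Qed.

Lemma oneDnsq_le_sqr p : oneDnsq p <= oneDnsq p ^+ 2.
Proof. by rewrite expr2 ler_peMl ?oneDnsq_ge1// ltW// oneDnsq_gt0. Qed.

Lemma measurable_oneDnsq : measurable_fun setT oneDnsq.
Proof.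
rewrite -[oneDnsq]/(fun p => 1 + (p.1 ^+ 2 + p.2 ^+ 2)).
apply: measurable_funD => //; apply: measurable_funD; apply: measurable_funX.
  exact: measurable_fst.
exact: measurable_snd.
Qed.

Lemma measurable_invr_gt0 d (T : measurableType d) (h : T -> R) :
  measurable_fun setT h -> (forall x, 0 < h x) ->
  measurable_fun setT (fun x => (h x)^-1).
Proof.
move=> mh h0; apply: (eq_measurable_fun (fun x => expR (- ln (h x)))).
  by move=> x _; rewrite expRN lnK// posrE.
apply: (measurableT_comp (@measurable_expR R)); apply: measurable_funN.
exact: (measurableT_comp (@measurable_ln R) mh).
Qed.

Lemma measurable_oneDnsqV n :
  measurable_fun setT (fun p => (oneDnsq p ^+ n)^-1).
Proof.
apply: measurable_invr_gt0; last by move=> p; rewrite exprn_gt0 ?oneDnsq_gt0.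
by apply: measurable_funX; exact: measurable_oneDnsq.
Qed.

(* Integrating out the second coordinate leaves (pi / 2) (1 + x^2)^(- 3 / 2). *)
Lemma integral_oneDnsq_sqrV :
  (\int[leb2 R]_p ((oneDnsq p ^+ 2)^-1)%:E = pi%:E)%E.
Proof.
have /measurable_EFinP mD := measurable_oneDnsqV 2.
have D0 p : (0 <= ((oneDnsq p ^+ 2)^-1)%:E)%E.
  by rewrite lee_fin invr_ge0 sqr_ge0.
apply: (etrans (@fubini_tonelli1 _ _ _ _ R (leb R) (leb R) _ mD D0)).
transitivity (\int[leb R]_x
    ((pi / 2)%:E * ((Num.sqrt (1 + x ^+ 2) ^+ 3)^-1)%:E))%E.
  apply: eq_integral => x _; have s0 := sqrt_oneDsqr_gt0 x.
  rewrite -EFinM; have -> : pi / 2 * (Num.sqrt (1 + x ^+ 2) ^+ 3)^-1 =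
      pi / (2 * Num.sqrt (1 + x ^+ 2) ^+ 3) by field; rewrite gt_eqF.
  rewrite -(integralT_sqr_addsqrV s0); apply: eq_integral => y _.
  by rewrite sqr_sqrt_oneDsqr /oneDnsq /nsq /= addrA.
rewrite ge0_integralZl_EFin//.
- by rewrite integralT_sqrt_oneDsqr_cubeV -EFinM; congr _%:E; field.
- apply/measurable_EFinP; apply: measurable_invr_gt0 => [|x]; last first.
    by rewrite exprn_gt0 ?sqrt_oneDsqr_gt0.
  apply: measurable_funX; apply: continuous_measurable_fun.
  exact: (is_derive1_continuous is_derive1_sqrt_oneDsqr).
- by rewrite divr_ge0// pi_ge0.
Qed.

Lemma has_Rintegral_oneDnsq_sqrV :
  has_Rintegral (leb2 R) (fun p => (oneDnsq p ^+ 2)^-1) pi.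
Proof.
apply: ge0_has_Rintegral; first exact: measurable_oneDnsqV.
  by move=> p; rewrite invr_ge0 sqr_ge0.
exact: integral_oneDnsq_sqrV.
Qed.

Lemma has_Rintegral_oneDsqrV :
  has_Rintegral (leb R) (fun x : R => (1 + x ^+ 2)^-1) pi.
Proof.
apply: ge0_has_Rintegral; last exact: integralT_oneDsqrV.
  by apply: continuous_measurable_fun; exact: continuous_oneDsqrV.
by move=> x; rewrite invr_ge0 addr_ge0 ?sqr_ge0.
Qed.

Definition tame f : Prop :=
  [/\ measurable_fun setT f,
      forall x, continuous (fun y => f (x, y)),
      forall y, continuous (fun x => f (x, y)) &
      exists2 K : R, 0 <= K & forall p, `|f p| <= K * (oneDnsq p ^+ 2)^-1].

Lemma tame_lin (a b : R) f g : tame f -> tame g ->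
  tame (fun p => a * f p + b * g p).
Proof.
move=> [mf fx fy [K K0 fK]] [mg gx gy [L L0 gL]]; split.
- by apply: measurable_funD; apply: measurable_funM.
- by move=> x y; apply: cvgD; apply: cvgMr; [exact: fx|exact: gx].
- by move=> y x; apply: cvgD; apply: cvgMr; [exact: fy|exact: gy].
- exists (`|a| * K + `|b| * L); first by rewrite addr_ge0 ?mulr_ge0.
  move=> p; rewrite mulrDl; apply: (le_trans (ler_normD _ _)).
  by rewrite !normrM -!mulrA lerD// ler_wpM2l.
Qed.

Lemma tame_integrable f : tame f -> (leb2 R).-integrable setT (EFin \o f).
Proof.
move=> [mf _ _ [K K0 fK]].
have := integrableZl measurableT K has_Rintegral_oneDnsq_sqrV.1.
apply: le_integrable => //; first exact/measurable_EFinP.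
by move=> p _; rewrite /= lee_fin (le_trans (fK p))// ler_norm.
Qed.

Lemma tame_swap f : tame f -> tame (f \o swap_pair).
Proof.
move=> [mf fx fy [K K0 fK]]; split=> //.
  exact: (measurableT_comp mf (@measurable_swap _ _ _ _)).
by exists K => // p; rewrite -oneDnsq_swap; exact: fK.
Qed.

Lemma has_Rintegral_swap f v : tame f ->
  has_Rintegral (leb2 R) (f \o swap_pair) v -> has_Rintegral (leb2 R) f v.
Proof.
move=> tf [_ <-]; have fi := tame_integrable tf; split=> //.
have fsi := tame_integrable (tame_swap tf).
by rewrite /Rintegral -(integral12_prod_meas1 fi) -(integral21_prod_meas1 fsi).
Qed.

Lemma integralT_derive_eq0 (h H : R -> R) (K : R) : continuous h ->
  (forall x, `|h x| <= K * (1 + x ^+ 2)^-1) ->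
  (forall x : R, is_derive x 1 H (h x)) ->
  (forall x, 1 <= `|x| -> `|H x| <= `|x|^-1) ->
  (\int[leb R]_x (h x)%:E = 0)%E.
Proof.
move=> ch hK dH Hx; have ih : (leb R).-integrable setT (EFin \o h).
  have := integrableZl measurableT K has_Rintegral_oneDsqrV.1.
  apply: le_integrable => //.
    by apply/measurable_EFinP; exact: continuous_measurable_fun.
  by move=> x _; rewrite /= lee_fin (le_trans (hK x))// ler_norm.
rewrite (integralT_FTC (l := 0) (l' := 0) ih ch dH) ?subr0//.
  apply: cvgy_le_inv => x x1.
  have nx : `|x| = x by rewrite ger0_norm ?(le_trans ler01).
  by rewrite -{2}nx Hx ?nx.
apply/cvgNy_compNP; apply: cvgy_le_inv => x x1.
have nx : `|- x| = x by rewrite normrN ger0_norm ?(le_trans ler01).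
by rewrite -{2}nx Hx ?nx.
Qed.

Lemma has_Rintegral_dx_eq0 f F : tame f ->
  (forall x y : R, is_derive x 1 (fun t => F (t, y)) (f (x, y))) ->
  (forall p, 1 <= `|p.1| -> `|F p| <= `|p.1|^-1) -> has_Rintegral (leb2 R) f 0.
Proof.
move=> tf dF Fp; have fi := tame_integrable tf; split=> //.
rewrite /Rintegral -(integral21_prod_meas1 fi) integral0_eq// => y _.
have [_ _ cf [K K0 fK]] := tf.
apply: (@integralT_derive_eq0 _ (fun x => F (x, y)) K (cf y)) => // x.
  apply: (le_trans (fK _)); rewrite ler_wpM2l// lef_pV2 ?posrE.
  - exact: le_trans (oneDsqr_le_oneDnsq (x, y)) (oneDnsq_le_sqr _).
  - by rewrite exprn_gt0 ?oneDnsq_gt0.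
  - by rewrite ltr_pwDl ?sqr_ge0.
exact: (Fp (x, y)).
Qed.

End Plane.

Section ComplexDerivative.
Context {R : realType}.
Implicit Types (f g : R -> R[i]) (df dg : R[i]) (x : R).

Definition is_cderive f x df : Prop :=
  is_derive x 1 (fun t => complex.Re (f t)) (complex.Re df) /\
  is_derive x 1 (fun t => complex.Im (f t)) (complex.Im df).

Lemma is_cderiveM f g x df dg : is_cderive f x df -> is_cderive g x dg ->
  is_cderive (fun t => f t * g t) x (df * g x + f x * dg).
Proof.
move=> [fr fi] [gr gi]; split.
  under eq_fun do rewrite cReM.
  apply: (is_derive_eq (is_deriveB (is_derive1M fr gr) (is_derive1M fi gi))).
  by rewrite cReD !cReM; ring.
under eq_fun do rewrite cImM.
apply: (is_derive_eq (is_deriveD (is_derive1M fr gi) (is_derive1M fi gr))).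
by rewrite cImD !cImM; ring.
Qed.

Lemma is_cderive_cst (c : R[i]) x : is_cderive (fun=> c) x 0.
Proof. by split; exact: is_derive_cst. Qed.

Lemma is_cderiveX f n x df : is_cderive f x df ->
  is_cderive (fun t => f t ^+ n) x (n%:R * f x ^+ n.-1 * df).
Proof.
move=> hf; elim: n => [|n IHn].
  by under eq_fun do rewrite expr0; rewrite !mul0r; exact: is_cderive_cst.
under eq_fun do rewrite exprS.
have := is_cderiveM hf IHn; congr is_cderive.
by rewrite /= -natr1; case: n {IHn} => [|n] /=; rewrite ?expr0 ?exprS; ring.
Qed.

Lemma is_cderive_real (h : R -> R) x (dh : R) : is_derive x 1 h dh ->
  is_cderive (fun t => (h t)%:C) x dh%:C.
Proof. by move=> dhx; split => //; exact: is_derive_cst. Qed.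

Lemma is_cderive_conjc f x df : is_cderive f x df ->
  is_cderive (fun t => conjc (f t)) x (conjc df).
Proof.
move=> [fr fi]; split; rewrite ?cRe_conjc ?cIm_conjc.
  by under eq_fun do rewrite cRe_conjc.
by under eq_fun do rewrite cIm_conjc; exact: is_deriveN.
Qed.

Lemma is_derive1_nsq f x df : is_cderive f x df ->
  is_derive x 1 (fun t => nsq (f t))
    (2 * (complex.Re (f x) * complex.Re df + complex.Im (f x) * complex.Im df)).
Proof.
move=> [fr fi].
apply: (is_derive_eq (is_deriveD (is_derive1X 2 fr) (is_derive1X 2 fi))).
by rewrite /= !expr1; ring.
Qed.

Lemma is_cderive_cplx1 (x y : R) : is_cderive (fun s => cplx (s, y)) x 1.
Proof. by split; [exact: is_derive_id|exact: is_derive_cst]. Qed.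

Lemma is_cderive_cplx2 (x y : R) : is_cderive (fun s => cplx (x, s)) y 'i.
Proof. by split; [exact: is_derive_cst|exact: is_derive_id]. Qed.

End ComplexDerivative.

Section ComplexPlane.
Context {R : realType}.
Implicit Types (p : R * R) (h H : R * R -> R[i]).

Definition ctame h : Prop :=
  tame (fun p => complex.Re (h p)) /\ tame (fun p => complex.Im (h p)).

Lemma ctame_lin (a b : R[i]) h1 h2 : ctame h1 -> ctame h2 ->
  ctame (fun p => a * h1 p + b * h2 p).
Proof.
move=> [r1 i1] [r2 i2]; split.
  have := tame_lin 1 1 (tame_lin (complex.Re a) (- complex.Im a) r1 i1)
    (tame_lin (complex.Re b) (- complex.Im b) r2 i2); congr tame.
  by apply/funext => p; rewrite cReD !cReM; ring.
have := tame_lin 1 1 (tame_lin (complex.Im a) (complex.Re a) r1 i1)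
  (tame_lin (complex.Im b) (complex.Re b) r2 i2); congr tame.
by apply/funext => p; rewrite cImD !cImM; ring.
Qed.

Lemma ctame_conjc h : ctame h -> ctame (fun p => conjc (h p)).
Proof.
move=> [hr hi]; split; first by under eq_fun do rewrite cRe_conjc.
have := tame_lin (-1) 0 hi hi; congr tame.
by apply/funext => p; rewrite cIm_conjc mul0r addr0 mulN1r.
Qed.

Lemma has_cintegral_dx_eq0 h H : ctame h ->
  (forall x y, is_cderive (fun t => H (t, y)) x (h (x, y))) ->
  (forall p, 1 <= `|p.1| -> nsq (H p) <= (`|p.1|^-1) ^+ 2) ->
  has_cintegral (leb2 R) h 0.
Proof.
move=> [hr hi] dH Hp; split.
  apply: (has_Rintegral_dx_eq0 (F := fun p => complex.Re (H p)) hr).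
    by move=> x y; exact: (dH x y).1.
  by move=> p p1; apply: norm_cRe_le; [rewrite invr_ge0|exact: Hp].
apply: (has_Rintegral_dx_eq0 (F := fun p => complex.Im (H p)) hi).
  by move=> x y; exact: (dH x y).2.
by move=> p p1; apply: norm_cIm_le; [rewrite invr_ge0|exact: Hp].
Qed.

Lemma has_cintegral_dy_eq0 h H : ctame h ->
  (forall x y, is_cderive (fun t => H (x, t)) y (h (x, y))) ->
  (forall p, 1 <= `|p.2| -> nsq (H p) <= (`|p.2|^-1) ^+ 2) ->
  has_cintegral (leb2 R) h 0.
Proof.
move=> [hr hi] dH Hp.
have [hr0 hi0] : has_cintegral (leb2 R) (h \o swap_pair) 0.
  apply: (has_cintegral_dx_eq0 (H := H \o swap_pair)) => [|x y|p].
  - exact: conj (tame_swap hr) (tame_swap hi).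
  - exact: dH.
  - exact: (Hp (swap_pair p)).
exact: conj (has_Rintegral_swap hr hr0) (has_Rintegral_swap hi hi0).
Qed.

End ComplexPlane.

Section ComplexMeasurable.
Context d (T : measurableType d) {R : realType}.
Implicit Types h : T -> R[i].

Definition cmeasurable h : Prop :=
  measurable_fun setT (fun x => complex.Re (h x)) /\
  measurable_fun setT (fun x => complex.Im (h x)).

Lemma cmeasurableM h1 h2 : cmeasurable h1 -> cmeasurable h2 ->
  cmeasurable (fun x => h1 x * h2 x).
Proof.
move=> [r1 i1] [r2 i2]; split.
  under eq_fun do rewrite cReM.
  by apply: measurable_funB; apply: measurable_funM.
under eq_fun do rewrite cImM.
by apply: measurable_funD; apply: measurable_funM.
Qed.

Lemma cmeasurableX h n : cmeasurable h -> cmeasurable (fun x => h x ^+ n).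
Proof.
move=> mh; elim: n => [|n IHn].
  by under eq_fun do rewrite expr0; split; exact: measurable_cst.
by under eq_fun do rewrite exprS; exact: cmeasurableM.
Qed.

Lemma cmeasurable_conjc h : cmeasurable h -> cmeasurable (fun x => conjc (h x)).
Proof.
move=> [hr hi]; split; first by under eq_fun do rewrite cRe_conjc.
by under eq_fun do rewrite cIm_conjc; exact: measurable_funN.
Qed.

End ComplexMeasurable.

(** * Moments of the Fubini-Study measure *)

Section Monomials.
Context {R : realType}.
Implicit Types (i j k N : nat) (p : R * R).

Definition mono i j N p : R[i] :=
  cplx p ^+ i * conjc (cplx p) ^+ j * ((oneDnsq p ^+ N)^-1)%:C.

Definition mono_dz i j N p : R[i] :=
  i%:R * mono i.-1 j N p + - N%:R * mono i j.+1 N.+1 p.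

Lemma conjc_mono i j N p : conjc (mono i j N p) = mono j i N p.
Proof.
rewrite /mono; move: (cplx p) (_^-1) => z r.
rewrite !rmorphM !rmorphXn [X in _ * X]conjc_real /= conjcK.
by rewrite mulrAC mulrC mulrA.
Qed.

Lemma conjc_mono_dz i j N p : conjc (mono_dz i j N p) =
  i%:R * mono j i.-1 N p + - N%:R * mono j.+1 i N.+1 p.
Proof.
rewrite -(conjc_mono i.-1) -(conjc_mono i) /mono_dz; move: (mono _ _ _ _) => a.
by move: (mono _ _ _ _) => b; rewrite rmorphD !rmorphM rmorphN !rmorph_nat.
Qed.

(* Wirtinger calculus: the derivative of h in the direction u is
   u h_z + conj(u) h_zbar, and h_zbar is the conjugate of (conj h)_z. *)
Lemma is_cderive_mono (c : R -> R * R) i j N t u :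
  is_cderive (fun s => cplx (c s)) t u ->
  is_cderive (fun s => mono i j N (c s)) t
    (u * mono_dz i j N (c t) + conjc u * conjc (mono_dz j i N (c t))).
Proof.
move=> dz; have dzb := is_cderive_conjc dz; set z := cplx (c t).
pose dD := 2 * (complex.Re z * complex.Re u + complex.Im z * complex.Im u).
have derD : is_derive t 1 (fun s => oneDnsq (c s)) dD.
  have := is_deriveD (is_derive_cst (1 : R) t 1) (is_derive1_nsq dz).
  by rewrite add0r.
have DN0 := oneDnsq_neq0 (c t).
have dDV := is_derive1V (f := fun s => oneDnsq (c s) ^+ N) (expf_neq0 N DN0)
  (is_derive1X N derD).
have := is_cderiveM (is_cderiveM (is_cderiveX i dz) (is_cderiveX j dzb))
  (is_cderive_real dDV); congr is_cderive.
have dDE : dD%:C = z * conjc u + conjc z * u.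
  by apply: complex_ext; rewrite /dD ?(cReD, cImD) ?(cReM, cImM);
    rewrite !(cRe_conjc, cIm_conjc) /=; ring.
set D := oneDnsq (c t) in DN0 *.
have -> : (- (N%:R * D ^+ N.-1 * dD) / (D ^+ N) ^+ 2)%:C =
    - N%:R * (z * conjc u + conjc z * u) * ((D ^+ N.+1)^-1)%:C.
  rewrite -dDE -(rmorph_nat (real_complex R)) -rmorphN -!rmorphM; congr (_%:C).
  case: (N) => [|n] /=; first by rewrite !mul0r oppr0 !mul0r.
  by rewrite !exprS; field; rewrite DN0 expf_neq0.
rewrite conjc_mono_dz /mono_dz /mono -/z -/D.
by rewrite !exprS; ring.
Qed.

Lemma nsq_mono_le i j k N p : (i + j + k <= 2 * N)%N ->
  nsq (mono i j N p) <= (oneDnsq p ^+ k)^-1.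
Proof.
move=> ijk; rewrite /mono !nsqM !nsqX nsq_conjc nsq_real -exprD.
have D0 := oneDnsq_gt0 p; rewrite exprVn -exprM mulnC.
rewrite ler_pdivrMr ?exprn_gt0// mulrC ler_pdivlMr ?exprn_gt0//.
apply: (@le_trans _ _ (oneDnsq p ^+ (i + j) * oneDnsq p ^+ k)).
  rewrite ler_wpM2r ?exprn_ge0 ?(ltW D0)//.
  by rewrite lerXn2r ?nnegrE ?nsq_ge0 ?(ltW D0)// lerDr.
by rewrite -exprD ler_weXn2l ?oneDnsq_ge1.
Qed.

Lemma cmeasurable_mono i j N : cmeasurable (mono i j N).
Proof.
have mz : cmeasurable (fun p : R * R => cplx p).
  by split; [exact: measurable_fst|exact: measurable_snd].
apply: cmeasurableM; last first.
  by split; [exact: measurable_oneDnsqV|exact: measurable_cst].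
by apply: cmeasurableM; apply: cmeasurableX => //; exact: cmeasurable_conjc.
Qed.

Lemma ctame_mono i j N : (i + j + 4 <= 2 * N)%N -> ctame (mono i j N).
Proof.
move=> ij; have [mr mi] := cmeasurable_mono i j N.
have dx x y := is_cderive_mono i j N (@is_cderive_cplx1 R x y).
have dy x y := is_cderive_mono i j N (@is_cderive_cplx2 R x y).
have D0 p : 0 <= (oneDnsq p ^+ 2)^-1 by rewrite invr_ge0 sqr_ge0.
have le p : nsq (mono i j N p) <= ((oneDnsq p ^+ 2)^-1) ^+ 2.
  by rewrite exprVn -exprM; exact: nsq_mono_le.
split; split => //.
- by move=> x; apply: is_derive1_continuous => y; exact: (dy x y).1.
- by move=> y; apply: is_derive1_continuous => x; exact: (dx x y).1.
- by exists 1 => // p; rewrite mul1r norm_cRe_le.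
- by move=> x; apply: is_derive1_continuous => y; exact: (dy x y).2.
- by move=> y; apply: is_derive1_continuous => x; exact: (dx x y).2.
- by exists 1 => // p; rewrite mul1r norm_cIm_le.
Qed.

Lemma ctame_mono_dz i j N : (i + j + 3 <= 2 * N)%N -> ctame (mono_dz i j N).
Proof.
move=> ij; have tz : ctame (mono i j.+1 N.+1) by apply: ctame_mono; lia.
case: i => [|i] in ij tz *; last first.
  by apply: ctame_lin => //; apply: ctame_mono => /=; lia.
have := ctame_lin 0 (- N%:R) tz tz; congr ctame.
by apply/funext => p; rewrite /mono_dz !mul0r.
Qed.

Lemma has_cintegral_mono_dz i j N : (i + j + 3 <= 2 * N)%N ->
  has_cintegral (leb2 R) (mono_dz i j N) 0.
Proof.
move=> ij; have tz := ctame_mono_dz ij.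
have tzb : ctame (fun p => conjc (mono_dz j i N p)).
  by apply/ctame_conjc/ctame_mono_dz; rewrite (addnC j).
have decay p r : 1 <= `|r| -> 1 + r ^+ 2 <= oneDnsq p ->
    nsq (mono i j N p) <= (`|r|^-1) ^+ 2.
  move=> r1 rp; have r0 : 0 < `|r| by exact: lt_le_trans r1.
  apply: (le_trans (nsq_mono_le (k := 1) _ _)); first by lia.
  rewrite expr1 exprVn lef_pV2 ?posrE ?oneDnsq_gt0 ?exprn_gt0//.
  by rewrite real_normK ?num_real// (le_trans _ rp)// lerDr.
have oneDsqr2_le_oneDnsq p : 1 + p.2 ^+ 2 <= oneDnsq p.
  by rewrite -oneDnsq_swap; exact: (oneDsqr_le_oneDnsq (swap_pair p)).
have ix := has_cintegral_dx_eq0 (ctame_lin 1 (conjc 1) tz tzb)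
  (fun x y => is_cderive_mono i j N (is_cderive_cplx1 x y))
  (fun p rp => decay p _ rp (oneDsqr_le_oneDnsq p)).
have iy := has_cintegral_dy_eq0 (ctame_lin 'i (conjc 'i) tz tzb)
  (fun x y => is_cderive_mono i j N (is_cderive_cplx2 x y))
  (fun p rp => decay p _ rp (oneDsqr2_le_oneDnsq p)).
have := has_cintegralD (has_cintegralZ 2^-1 ix) (has_cintegralZ (- 'i / 2) iy).
rewrite !mulr0 addr0; apply: eq_has_cintegral => p.
have -> : conjc 'i = - 'i :> R[i] by apply: complex_ext; rewrite /= ?oppr0.
rewrite conjc1; move: (mono_dz i j N p) (conjc _) => a b.
have -> : - 'i / 2 * ('i * a + - 'i * b) = - 'i ^+ 2 / 2 * (a - b) :> R[i].
  by ring.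
by rewrite sqr_i; field.
Qed.

End Monomials.

Lemma natr_bin_neq0 (K : numDomainType) (n m : nat) :
  (m <= n)%N -> ('C(n, m)%:R : K) != 0.
Proof. by move=> mn; rewrite pnatr_eq0 -lt0n bin_gt0. Qed.

Section Moments.
Context {R : realType}.

Lemma has_cintegral_monoS i j N v : (i + j + 3 <= 2 * N.+1)%N ->
  has_cintegral (leb2 R) (fun p => i%:R * @mono R i.-1 j N.+1 p) v ->
  has_cintegral (leb2 R) (@mono R i j.+1 N.+2) (v / N.+1%:R).
Proof.
move=> ij iv; have idz := @has_cintegral_mono_dz R i j N.+1 ij.
have N0 : (N.+1%:R : R[i]) != 0 by rewrite pnatr_eq0.
have := has_cintegralZ N.+1%:R^-1 (has_cintegralD iv (has_cintegralZ (-1) idz)).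
rewrite mulr0 addr0 mulrC; apply: eq_has_cintegral => p.
by rewrite /mono_dz; field.
Qed.

Lemma mono00_split N (p : R * R) :
  mono 0 0 N p = mono 0 0 N.+1 p + mono 1 1 N.+1 p.
Proof.
rewrite /mono !expr0 !expr1 !mul1r mulc_conjc -rmorphM -rmorphD; congr (_%:C).
have -> : nsq (cplx p) = oneDnsq p - 1 by rewrite /oneDnsq addrC addKr.
have D0 := oneDnsq_neq0 p.
by rewrite exprS; field; rewrite D0 expf_neq0.
Qed.

Lemma moment_mono00 tau :
  has_cintegral (leb2 R) (@mono R 0 0 tau.+2) (pi%:C / tau.+1%:R).
Proof.
elim: tau => [|tau IHtau].
  have -> : mono 0 0 2 = fun p => ((oneDnsq p ^+ 2)^-1)%:C :> R[i].
    by apply/funext => p; rewrite /mono !expr0 !mul1r.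
  rewrite divr1; split; first exact: has_Rintegral_oneDnsq_sqrV.
  by split; [exact: integrable0|rewrite /Rintegral integral0].
have m11 : has_cintegral (leb2 R) (@mono R 1 1 tau.+3)
    (1%:R * (pi%:C / tau.+1%:R) / tau.+2%:R).
  by apply: has_cintegral_monoS; [lia|exact: has_cintegralZ].
have := has_cintegralD IHtau (has_cintegralZ (-1) m11).
rewrite (_ : _ + _ = pi%:C / tau.+2%:R).
  by apply: eq_has_cintegral => p; rewrite (mono00_split tau.+2) mulN1r addrK.
by field; rewrite -natrD nat1r !pnatr_eq0.
Qed.

Lemma moment_mono tau i j : (i <= tau)%N -> (j <= tau)%N ->
  has_cintegral (leb2 R) (@mono R i j tau.+2)
    ((i == j)%:R * pi%:C / (tau.+1%:R * 'C(tau, i)%:R)).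
Proof.
have vanish t m : (m.+1 <= t)%N ->
    has_cintegral (leb2 R) (@mono R 0 m.+1 t.+2) 0.
  move=> mt; rewrite -(mul0r t.+1%:R^-1).
  apply: has_cintegral_monoS; first by lia.
  by apply: eq_has_cintegral (has_cintegral0 _) => p; rewrite mul0r.
elim: tau i j => [|tau IHtau] [|i] [|j] //= hi hj.
- by rewrite bin0 mul1r mulr1; exact: moment_mono00.
- by rewrite bin0 mul1r mulr1; exact: moment_mono00.
- by rewrite !mul0r; exact: vanish.
- rewrite !mul0r -conjc0.
  apply: eq_has_cintegral (has_cintegral_conjc (vanish _ _ hi)) => p.
  exact: conjc_mono.
have ij : (i.+1 + j + 3 <= 2 * tau.+2)%N by lia.
have := has_cintegral_monoS ij (has_cintegralZ i.+1%:R (IHtau i j hi hj)).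
congr has_cintegral; rewrite eqSS.
have binV : 'C(tau.+1, i.+1)%:R^-1 =
    i.+1%:R / (tau.+1%:R * 'C(tau, i)%:R) :> R[i].
  rewrite -natrM (_ : tau.+1 * _ = i.+1 * 'C(tau.+1, i.+1))%N ?mul_bin_diag//.
  by rewrite natrM invfM mulVKf ?pnatr_eq0.
by rewrite [in RHS]invfM binV; ring.
Qed.

Lemma dens_mono tau i j (p : R * R) :
  cplx p ^+ i * conjc (cplx p) ^+ j * (dens tau (cplx p))%:C =
  tau.+1%:R / pi%:C * mono i j tau.+2 p.
Proof.
rewrite /mono mulrCA; congr (_ * _).
rewrite -(rmorph_nat (real_complex R)) -fmorphV -!rmorphM; congr (_%:C).
rewrite /dens -/(oneDnsq p) -[tau.+2]addn2 exprD mul1r !invfM; ring.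
Qed.

Lemma moment tau i j : (i <= tau)%N -> (j <= tau)%N ->
  has_cintegral (leb2 R)
    (fun p : R * R =>
       cplx p ^+ i * conjc (cplx p) ^+ j * (dens tau (cplx p))%:C)
    ((i == j)%:R / 'C(tau, i)%:R).
Proof.
move=> hi hj; have := has_cintegralZ (tau.+1%:R / pi%:C) (moment_mono hi hj).
have -> : tau.+1%:R / pi%:C *
      ((i == j)%:R * pi%:C / (tau.+1%:R * 'C(tau, i)%:R)) =
    (i == j)%:R / 'C(tau, i)%:R :> R[i].
  have pi0 : (pi%:C : R[i]) != 0 by rewrite fmorph_eq0 gt_eqF ?pi_gt0.
  have t0 : (tau.+1%:R : R[i]) != 0 by rewrite pnatr_eq0.
  rewrite invfM; move: pi%:C pi0 (tau.+1%:R : R[i]) t0 => x x0 t t0.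
  by field; rewrite natr_bin_neq0 ?t0 ?x0.
by apply: eq_has_cintegral => p; rewrite dens_mono.
Qed.

Lemma moment2 mu nu i j k l :
  (i <= mu)%N -> (j <= nu)%N -> (k <= mu)%N -> (l <= nu)%N ->
  has_cintegral (leb4 R)
    (fun q : R * R * R * R =>
       cz q ^+ i * cw q ^+ j * conjc (cz q ^+ k * cw q ^+ l)
       * (dens mu (cz q) * dens nu (cw q))%:C)
    ((i == k)%:R / 'C(mu, i)%:R * ((j == l)%:R / 'C(nu, j)%:R)).
Proof.
move=> hi hj hk hl; have := has_cintegral_leb4M (moment hi hk) (moment hj hl).
apply: eq_has_cintegral => q.
rewrite -[cplx q.1.1]/(cz q) -[cplx (_, _)]/(cw q).
by rewrite !rmorphM !rmorphXn /=; ring.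
Qed.

End Moments.

(** * Coefficients of the kernel *)

(* A power series in [z] and [w] is represented by its coefficients [f i j]. *)
Section BivariateCoefficients.
Context {K : comNzRingType}.
Implicit Types f : nat -> nat -> K.

Definition mulz f (i j : nat) : K := if i is i'.+1 then f i' j else 0.
Definition mulw f (i j : nat) : K := if j is j'.+1 then f i j' else 0.
Definition mulzBw f (i j : nat) : K := mulz f i j - mulw f i j.

(* (1 + z) d/dz + (1 + w) d/dw *)
Definition lowering f (i j : nat) : K :=
  i.+1%:R * f i.+1 j + j.+1%:R * f i j.+1 + (i%:R + j%:R) * f i j.

(* z (1 + z) d/dz + w (1 + w) d/dw *)
Definition raising f (i j : nat) : K := (i%:R + j%:R) * f i j
  + mulz (fun i' j' => i'%:R * f i' j') i j
  + mulw (fun i' j' => j'%:R * f i' j') i j.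

Lemma lowering_mulzBw f i j :
  lowering (mulzBw f) i j = mulzBw (lowering f) i j + mulzBw f i j.
Proof.
by rewrite /lowering /mulzBw; case: i j => [|i] [|j] /=; rewrite -?natr1; ring.
Qed.

Lemma raising_mulzBw f i j : raising (mulzBw f) i j = mulzBw (raising f) i j
  + mulzBw (fun i' j' => f i' j' + mulz f i' j' + mulw f i' j') i j.
Proof.
rewrite /raising /mulzBw.
by case: i j => [|[|i]] [|[|j]] /=; rewrite -?natr1; ring.
Qed.

Definition psum (e : nat -> K) f (m n : nat) (z w : K) : K :=
  \sum_(i < m) \sum_(j < n) f i j * e (i + j)%N * z ^+ i * w ^+ j.

Lemma psum_mulz e f m n z w : (forall i, f i n = 0) ->
  psum e (mulz f) m.+1 n.+1 z w = z * psum (e \o succn) f m n z w.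
Proof.
move=> fn0; rewrite /psum big_ord_recl [X in X + _ = _]big1 ?add0r.
  rewrite mulr_sumr; apply: eq_bigr => i _.
  rewrite big_ord_recr /= fn0 !mul0r addr0.
  by rewrite mulr_sumr; apply: eq_bigr => j _; rewrite /= exprS; ring.
by move=> j _; rewrite /= !mul0r.
Qed.

Lemma psum_mulw e f m n z w : (forall j, f m j = 0) ->
  psum e (mulw f) m.+1 n.+1 z w = w * psum (e \o succn) f m n z w.
Proof.
move=> fm0; rewrite /psum big_ord_recr [X in _ + X = _]big1 ?addr0.
  rewrite mulr_sumr; apply: eq_bigr => i _.
  rewrite big_ord_recl /= !mul0r add0r mulr_sumr; apply: eq_bigr => j _.
  by rewrite /= /bump /= add1n addnS exprS; ring.
by move=> [[|j] jn] _ /=; rewrite ?fm0 !mul0r.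
Qed.

Lemma psum_mulzBw e f m n z w :
  (forall i, f i n = 0) -> (forall j, f m j = 0) ->
  psum e (mulzBw f) m.+1 n.+1 z w = (z - w) * psum (e \o succn) f m n z w.
Proof.
move=> fn0 fm0; rewrite mulrBl -psum_mulz// -psum_mulw// /psum -sumrB.
apply: eq_bigr => i _; rewrite -sumrB; apply: eq_bigr => j _.
by rewrite /mulzBw; ring.
Qed.

End BivariateCoefficients.

Lemma mul_binSr (K : comNzRingType) (n i : nat) :
  i.+1%:R * 'C(n, i.+1)%:R = (n%:R - i%:R) * 'C(n, i)%:R :> K.
Proof.
rewrite -natrM mul_bin_left natrM.
by have [ni|ni] := leqP i n; [rewrite natrB|rewrite bin_small ?mulr0].
Qed.

Section Kernel.
Variables (K : comNzRingType) (a b : nat).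

(* The coefficient of z^i w^j in (z - w)^k (1 + z)^a (1 + w)^b. *)
Fixpoint gcoef (k : nat) : nat -> nat -> K :=
  if k is k'.+1 then mulzBw (gcoef k')
  else fun i j => 'C(a, i)%:R * 'C(b, j)%:R.

Lemma gcoef_eq0 k i j :
  [|| k + a < i, k + b < j, i + j < k | k + a + b < i + j]%N -> gcoef k i j = 0.
Proof.
elim: k i j => [|k IHk] i j out.
  have [ai|ia] := ltnP a i; first by rewrite /= bin_small ?mul0r.
  by rewrite /= ['C(b, j)]bin_small ?mulr0//; lia.
rewrite /= /mulzBw; case: i j out => [|i] [|j] out /=;
  by rewrite ?IHk ?subrr//; lia.
Qed.

Lemma lowering_gcoef k i j :
  lowering (gcoef k) i j = (k%:R + a%:R + b%:R) * gcoef k i j.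
Proof.
elim: k i j => [|k IHk] i j.
  rewrite /lowering /= mulrA mul_binSr mulrCA mul_binSr; ring.
rewrite /= lowering_mulzBw -natr1 /mulzBw.
by case: i j => [|i] [|j] /=; rewrite ?IHk; ring.
Qed.

Lemma raising_gcoef k i j : raising (gcoef k) i j =
  k%:R * gcoef k i j + (k%:R + a%:R) * mulz (gcoef k) i j
    + (k%:R + b%:R) * mulw (gcoef k) i j.
Proof.
elim: k i j => [|k IHk] i j.
  rewrite /raising; case: i j => [|i] [|j] /=;
    rewrite ?mulrDl ?mulrA ?mul_binSr;
    by rewrite ?[_.+1%:R * _ * 'C(b, _.+1)%:R]mulrAC ?mul_binSr; ring.
rewrite /= raising_mulzBw -natr1 /mulzBw.
case: i j => [|[|i]] [|[|j]] /=; rewrite ?IHk /=; ring.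
Qed.

Lemma gcoef_lower k i j : i.+1%:R * gcoef k i.+1 j + j.+1%:R * gcoef k i j.+1 =
  (k%:R + a%:R + b%:R - i%:R - j%:R) * gcoef k i j.
Proof.
have := lowering_gcoef k i j; rewrite /lowering => /(canRL (addrK _))->.
ring.
Qed.

Lemma gcoef_raise k i j : (i%:R + j%:R - k%:R) * gcoef k i j =
  (k%:R + a%:R + 1 - i%:R) * mulz (gcoef k) i j +
  (k%:R + b%:R + 1 - j%:R) * mulw (gcoef k) i j.
Proof.
rewrite mulrBl; apply/eqP; rewrite subr_eq; apply/eqP.
have := raising_gcoef k i j; rewrite /raising -addrA => /(canRL (addrK _))->.
by case: i j => [|i] [|j] /=; rewrite -?natr1; ring.
Qed.

Lemma gcoef_0l k l : gcoef k 0 (k + l) = (-1) ^+ k * 'C(b, l)%:R.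
Proof.
elim: k => [|k IHk]; first by rewrite /= bin0 expr0.
by rewrite addSn /= /mulzBw /= IHk exprS; ring.
Qed.

Lemma gcoef_expand k (z w xi : K) :
  (z - w) ^+ k * (1 + xi * z) ^+ a * (1 + xi * w) ^+ b =
  psum (fun d => xi ^+ (d - k)) (gcoef k) (k + a).+1 (k + b).+1 z w.
Proof.
elim: k => [|k IHk].
  rewrite expr0 mul1r !exprDn big_distrlr /=.
  apply: eq_bigr => i _; apply: eq_bigr => j _.
  by rewrite !expr1n !mul1r !exprMn subn0 exprD
    -[_ *+ 'C(a, i)]mulr_natr -[_ *+ 'C(b, j)]mulr_natr; ring.
rewrite exprS -!mulrA [X in _ * X]mulrA IHk !addSn /= psum_mulzBw// => [i|j].
  by rewrite gcoef_eq0// ltnSn orbT.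
by rewrite gcoef_eq0// ltnSn.
Qed.

End Kernel.

Lemma rmorph_gcoef (K L : comNzRingType) (f : {rmorphism K -> L}) a b k i j :
  f (gcoef K a b k i j) = gcoef L a b k i j.
Proof.
elim: k i j => [|k IHk] i j /=; first by rewrite rmorphM !rmorph_nat.
by rewrite /mulzBw rmorphB; case: i j => [|i] [|j] /=; rewrite ?rmorph0 ?IHk.
Qed.

(** * Binomial identities *)

Lemma bin_bin_fact p q r :
  ('C(p + q + r, p) * 'C(q + r, q) * (p`! * (q`! * r`!)) = (p + q + r)`!)%N.
Proof.
have := bin_fact (leq_addr r q); rewrite addKn => qr.
have := bin_fact (leq_addr (q + r) p); rewrite addKn addnA => <-.
by rewrite -qr; lia.
Qed.

Lemma bin_binC p q r :
  ('C(p + q + r, p) * 'C(q + r, q) = 'C(p + q + r, q) * 'C(p + r, p))%N.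
Proof.
have fact0 : (0 < p`! * (q`! * r`!))%N by rewrite !muln_gt0 !fact_gt0.
apply/eqP; rewrite -(eqn_pmul2r fact0) bin_bin_fact.
by rewrite [X in _ == (_ * X)%N]mulnCA (addnC p q) bin_bin_fact.
Qed.

Lemma bin_binA p q r :
  ('C(p + q + r, p + q) * 'C(p + q, p) = 'C(p + q + r, p) * 'C(q + r, q))%N.
Proof.
have fact0 : (0 < p`! * (q`! * r`!))%N by rewrite !muln_gt0 !fact_gt0.
apply/eqP; rewrite -(eqn_pmul2r fact0) bin_bin_fact; apply/eqP.
have := bin_fact (leq_addr q p); rewrite addKn => pq.
by have := bin_fact (leq_addr r (p + q)); rewrite addKn => <-; rewrite -pq; lia.
Qed.

Lemma sum_bin_bin a b k :
  (\sum_(l < b.+1) 'C(a + (b - l), a) * 'C(k + l, k) = 'C(a + k + b.+1, b))%N.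
Proof.
elim: a b => [|a IHa] b.
  rewrite (eq_bigr (fun l : 'I_b.+1 => 'C(k + l, k))) => [|l _]; last first.
    by rewrite bin0 mul1n.
  elim: b => [|b IHb]; first by rewrite big_ord1 addn0 binn bin0.
  rewrite big_ord_recr /= IHb add0n (addnS k b.+1) binS addnC; congr (_ + _)%N.
  by rewrite -[RHS]bin_sub ?leq_addl// addnK.
elim: b => [|b IHb]; first by rewrite big_ord1 subn0 !addn0 !binn bin0.
have -> : (a.+1 + k + b.+2 = (a + k + b.+2).+1)%N by lia.
rewrite binS -IHa (_ : a + k + b.+2 = a.+1 + k + b.+1)%N -?IHb; last by lia.
rewrite big_ord_recr [X in (_ = X + _)%N]big_ord_recr /= !subnn !addn0 !binn.
rewrite addnAC; congr (_ + _)%N; rewrite -big_split /=; apply: eq_bigr => l _.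
have -> : (b.+1 - l = (b - l).+1)%N by have := ltn_ord l; lia.
by rewrite addSn binS mulnDl addnS addSn addnC.
Qed.

Lemma mul_bin_bin_succ a b k :
  ('C(k + a, k) * 'C(a + k + b.+1, b) * (k + a).+1 =
   'C(a + k + b.+1, k) * 'C(a + b, a) * (a + b).+1)%N.
Proof.
have ka : ('C(k + a, k) * (k + a).+1 = a.+1 * 'C(k + a.+1, k))%N.
  by rewrite mulnC -[(k + a)%N]/((k + a).+1.-1) mul_bin_down addnS -addnS addKn.
have ab : ('C(a + b, a) * (a + b).+1 = a.+1 * 'C(b + a.+1, b))%N.
  rewrite mulnC -[X in 'C(X, _)]/((a + b).+1.-1) -bin_sub ?leq_addr// addKn.
  by rewrite mul_bin_down addnC -addnS addKn.
have := bin_binC b k a.+1; rewrite (_ : b + k + a.+1 = a + k + b.+1)%N.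
  rewrite mulnAC ka -mulnA [('C(k + _, k) * _)%N]mulnC => ->.
  by rewrite -mulnA ab mulnCA.
by lia.
Qed.

(** * Matrix coefficients of the projection and of its adjoint *)

Section ProjectionCoefficients.
Variables (K : numFieldType) (a b k : nat) (c : K).
Local Notation g := (gcoef K a b k).

Definition proj_coef (i j : nat) : K :=
  c * g i j / ('C(k + a, i)%:R * 'C(k + b, j)%:R).
Definition adj_coef (i j : nat) : K := c * g i j / 'C(a + b, i + j - k)%:R.

(* The projection intertwines d/dz + d/dw with d/dxi. *)
Lemma proj_coef_lower i j : (i < k + a)%N -> (j <= k + b)%N ->
  i.+1%:R * proj_coef i j + j%:R * mulw proj_coef i.+1 j =
  (i.+1%:R + j%:R - k%:R) * proj_coef i.+1 j.
Proof.
move=> hi hj; have Cj := natr_bin_neq0 K hj.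
have Ci := natr_bin_neq0 K (ltnW hi); have Ci1 := natr_bin_neq0 K hi.
have coefi : k%:R + a%:R + 1 - i.+1%:R =
    i.+1%:R * 'C(k + a, i.+1)%:R / 'C(k + a, i)%:R :> K.
  by rewrite mul_binSr mulfK// natrD -natr1; ring.
have -> : (i.+1%:R + j%:R - k%:R) * proj_coef i.+1 j =
    c * ((i.+1%:R + j%:R - k%:R) * g i.+1 j) /
      ('C(k + a, i.+1)%:R * 'C(k + b, j)%:R) by rewrite /proj_coef; ring.
rewrite gcoef_raise coefi /proj_coef; move: (i.+1%:R : K) {coefi} => x.
case: j hj Cj => [|j] hj Cj /=; first by field; rewrite Ci Ci1 Cj.
have Cj1 := natr_bin_neq0 K (ltnW hj).
have -> : k%:R + b%:R + 1 - j.+1%:R =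
    j.+1%:R * 'C(k + b, j.+1)%:R / 'C(k + b, j)%:R :> K.
  by rewrite mul_binSr mulfK// natrD -natr1; ring.
by move: (j.+1%:R : K) => y; field; rewrite Ci Ci1 Cj Cj1.
Qed.

(* The adjoint intertwines d/dxi with d/dz + d/dw. *)
Lemma adj_coef_lower i j : (i + j < k + a + b)%N ->
  i.+1%:R * adj_coef i.+1 j + j.+1%:R * adj_coef i j.+1 =
  (i.+1%:R + j%:R - k%:R) * adj_coef i j.
Proof.
move=> ij_lt; have -> : i.+1%:R * adj_coef i.+1 j + j.+1%:R * adj_coef i j.+1 =
   c * (i.+1%:R * g i.+1 j + j.+1%:R * g i j.+1) / 'C(a + b, (i + j).+1 - k)%:R.
  by rewrite /adj_coef addSn addnS; ring.
rewrite gcoef_lower; have [ij_ltk|k_le] := ltnP (i + j) k.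
  by rewrite /adj_coef gcoef_eq0 ?ij_ltk ?orbT// !mulr0 !mul0r mulr0.
have [m ij] : {m | (i + j = m + k)%N} by exists (i + j - k)%N; lia.
rewrite /adj_coef ij -addSn !addnK.
have m_lt : (m < a + b)%N by lia.
have Cm := natr_bin_neq0 K (ltnW m_lt); have Cm1 := natr_bin_neq0 K m_lt.
have ijr : i%:R = m%:R + k%:R - j%:R :> K by rewrite -natrD -ij natrD addrK.
have -> : k%:R + a%:R + b%:R - i%:R - j%:R =
    m.+1%:R * 'C(a + b, m.+1)%:R / 'C(a + b, m)%:R :> K.
  by rewrite mul_binSr mulfK// natrD ijr; ring.
have -> : i.+1%:R + j%:R - k%:R = m.+1%:R :> K by rewrite -!natr1 ijr; ring.
by move: (m.+1%:R : K) => x; field; rewrite Cm Cm1.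
Qed.

(* The partial trace of P* P over the second factor commutes with d/dz, so its
   diagonal entries agree; the defect is a telescoping sum over j. *)
Lemma sum_proj_adj_coefS i : (i < k + a)%N ->
  \sum_(j < (k + b).+1) proj_coef i.+1 j * adj_coef i.+1 j =
  \sum_(j < (k + b).+1) proj_coef i j * adj_coef i j.
Proof.
move=> hi; pose t j := j%:R * adj_coef i j * mulw proj_coef i.+1 j.
have defect (j : 'I_(k + b).+1) : i.+1%:R *
    (proj_coef i.+1 j * adj_coef i.+1 j - proj_coef i j * adj_coef i j) =
    - (t j.+1 - t j).
  have hj : (j <= k + b)%N by rewrite -ltnS.
  pose adj_lower := i.+1%:R * adj_coef i.+1 j + j.+1%:R * adj_coef i j.+1.
  have lower_adj : adj_lower * proj_coef i.+1 j =
      (i.+1%:R + j%:R - k%:R) * adj_coef i j * proj_coef i.+1 j.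
    have [ij|ij] := ltnP (i + j) (k + a + b).
      by rewrite /adj_lower adj_coef_lower.
    rewrite /proj_coef gcoef_eq0 ?mulr0 ?mul0r ?mulr0//; lia.
  transitivity (adj_lower * proj_coef i.+1 j
    - adj_coef i j * (i.+1%:R * proj_coef i j + j%:R * mulw proj_coef i.+1 j)
    - (t j.+1 - t j)); first by rewrite /adj_lower /t /=; ring.
  by rewrite lower_adj (proj_coef_lower hi hj); ring.
have i0 : (i.+1%:R : K) != 0 by rewrite pnatr_eq0.
apply/eqP; rewrite -subr_eq0 -sumrB -(mulrI_eq0 _ (mulfI i0)) mulr_sumr.
rewrite (eq_bigr _ (fun j _ => defect j)) sumrN.
rewrite -(big_mkord xpredT (fun j => t j.+1 - t j)) telescope_sumr//.
rewrite /t !mul0r subr0 /adj_coef gcoef_eq0 ?ltnSn ?orbT//.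
by rewrite !mulr0 !mul0r mulr0 mul0r oppr0.
Qed.

Hypothesis sqr_c :
  c ^+ 2 = 'C(k + a, k)%:R * 'C(k + b, k)%:R / 'C(a + k + b.+1, k)%:R.

Lemma proj_adj_coef0 l : (l <= b)%N ->
  proj_coef 0 (k + l) * adj_coef 0 (k + l) =
  c ^+ 2 / ('C(k + b, k)%:R * 'C(a + b, a)%:R) *
    ('C(a + (b - l), a) * 'C(k + l, k))%:R.
Proof.
move=> lb; have [m bE] : {m | (b = l + m)%N} by exists (b - l)%N; lia.
have Ckl : ('C(k + b, k + l) * 'C(k + l, k) = 'C(k + b, k) * 'C(b, l))%N.
  by rewrite bE addnA bin_binA.
have Cal : ('C(a + b, l) * 'C(a + (b - l), a) = 'C(a + b, a) * 'C(b, l))%N.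
  by rewrite bE addKn addnA [(a + l)%N]addnC bin_binC.
have Ckl0 := natr_bin_neq0 K (leq_add (leqnn k) lb).
have Cal0 : ('C(a + b, l)%:R : K) != 0 by apply: natr_bin_neq0; lia.
have Ckb0 := natr_bin_neq0 K (leq_addr b k).
have Cab0 := natr_bin_neq0 K (leq_addr b a).
have CklE : 'C(k + l, k)%:R =
    'C(k + b, k)%:R * 'C(b, l)%:R / 'C(k + b, k + l)%:R :> K.
  by rewrite -natrM -Ckl natrM mulrC mulKf.
have CalE : 'C(a + (b - l), a)%:R =
    'C(a + b, a)%:R * 'C(b, l)%:R / 'C(a + b, l)%:R :> K.
  by rewrite -natrM -Cal natrM mulrC mulKf.
rewrite /proj_coef /adj_coef gcoef_0l bin0 mul1r add0n addKn natrM CklE CalE.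
transitivity (c ^+ 2 * ((-1) ^+ k) ^+ 2 * 'C(b, l)%:R ^+ 2 /
  ('C(k + b, k + l)%:R * 'C(a + b, l)%:R)); first by rewrite !invfM; ring.
by rewrite sqrr_sign; field; rewrite Ckl0 Cal0 Ckb0 Cab0.
Qed.

Lemma sum_proj_adj_coef0 : \sum_(j < (k + b).+1) proj_coef 0 j * adj_coef 0 j =
  (a + b).+1%:R / (k + a).+1%:R.
Proof.
rewrite -(big_mkord xpredT (fun j => proj_coef 0 j * adj_coef 0 j)).
rewrite (@big_cat_nat _ _ _ k)//=; last by lia.
rewrite big_nat big1 ?add0r => [|j /andP[_ jk]]; last first.
  by rewrite /proj_coef gcoef_eq0 ?jk ?orbT// mulr0 !mul0r.
rewrite -{1}[k]add0n big_addn subSn ?leq_addr// addKn big_mkord.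
transitivity (\sum_(l < b.+1) c ^+ 2 / ('C(k + b, k)%:R * 'C(a + b, a)%:R) *
    ('C(a + (b - l), a) * 'C(k + l, k))%:R).
  by apply: eq_bigr => l _; rewrite addnC proj_adj_coef0// -ltnS.
rewrite -mulr_sumr -natr_sum sum_bin_bin sqr_c.
have Ckb0 := natr_bin_neq0 K (leq_addr b k).
have Cab0 := natr_bin_neq0 K (leq_addr b a).
have C0 : 'C(a + k + b.+1, k)%:R != 0 :> K by apply: natr_bin_neq0; lia.
have ka0 : (k + a).+1%:R != 0 :> K by rewrite pnatr_eq0.
have /(congr1 (fun N => N%:R : K)) := mul_bin_bin_succ a b k.
rewrite !natrM => /(canRL (mulfK ka0)).
move: (k + a).+1%:R ('C(a + k + b.+1, k)%:R : K) ka0 C0 => x y x0 y0 binE.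
transitivity ('C(k + a, k)%:R * 'C(a + k + b.+1, b)%:R / (y * 'C(a + b, a)%:R)).
  by field; rewrite Ckb0 Cab0 y0.
by rewrite binE; field; rewrite Cab0 x0 y0.
Qed.

Lemma sum_proj_adj_coef i : (i <= k + a)%N ->
  \sum_(j < (k + b).+1) proj_coef i j * adj_coef i j =
  (a + b).+1%:R / (k + a).+1%:R.
Proof.
elim: i => [|i IHi] hi; first exact: sum_proj_adj_coef0.
by rewrite sum_proj_adj_coefS// IHi// ltnW.
Qed.

End ProjectionCoefficients.

(** * Spaces of polynomials *)

Section PolynomialSpaces.
Context {R : realType}.
Implicit Types (f g h : R[i] -> R[i]) (F G H : R[i] -> R[i] -> R[i]).

Lemma sum_natr_eqM (T : finType) (V : pzSemiRingType) (i : T) (u : T -> V) :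
  \sum_j (j == i)%:R * u j = u i.
Proof.
rewrite (bigD1 i)//= eqxx mul1r big1 ?addr0// => j /negbTE->.
by rewrite mul0r.
Qed.

Lemma sum2_natr_eqM (T1 T2 : finType) (V : pzSemiRingType) (i : T1) (j : T2)
    (u : T1 -> T2 -> V) :
  \sum_i' \sum_j' (i' == i)%:R * ((j' == j)%:R * u i' j') = u i j.
Proof.
rewrite -(sum_natr_eqM i (u ^~ j)); apply: eq_bigr => i' _.
by rewrite -mulr_sumr sum_natr_eqM.
Qed.

Definition pol tau (c : 'I_tau.+1 -> R[i]) (z : R[i]) : R[i] :=
  \sum_(i < tau.+1) c i * z ^+ i.

Definition pol2 mu nu (c : 'I_mu.+1 -> 'I_nu.+1 -> R[i]) (z w : R[i]) : R[i] :=
  \sum_(i < mu.+1) \sum_(j < nu.+1) c i j * z ^+ i * w ^+ j.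

Lemma Hsp_pol tau (c : 'I_tau.+1 -> R[i]) : Hsp tau (pol c).
Proof. by exists c. Qed.

Lemma HspP tau f : Hsp tau f -> exists c : 'I_tau.+1 -> R[i], f = pol c.
Proof. by move=> [c fc]; exists c; apply/funext => z; rewrite fc. Qed.

Lemma Hsp2_pol2 mu nu (c : 'I_mu.+1 -> 'I_nu.+1 -> R[i]) : Hsp2 mu nu (pol2 c).
Proof. by exists c. Qed.

Lemma Hsp2P mu nu F : Hsp2 mu nu F ->
  exists c : 'I_mu.+1 -> 'I_nu.+1 -> R[i], F = pol2 c.
Proof.
by move=> [c Fc]; exists c; apply/funext => z; apply/funext => w; rewrite Fc.
Qed.

Lemma pol_lin tau a (c e : 'I_tau.+1 -> R[i]) :
  (fun z => a * pol c z + pol e z) = pol (fun i => a * c i + e i).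
Proof.
apply/funext => z; rewrite /pol mulr_sumr -big_split /=.
by apply: eq_bigr => i _; ring.
Qed.

Lemma pol2_lin mu nu a (c e : 'I_mu.+1 -> 'I_nu.+1 -> R[i]) :
  (fun z w => a * pol2 c z w + pol2 e z w) =
  pol2 (fun i j => a * c i j + e i j).
Proof.
apply/funext => z; apply/funext => w; rewrite /pol2 mulr_sumr -big_split /=.
apply: eq_bigr => i _; rewrite mulr_sumr -big_split /=.
by apply: eq_bigr => j _; ring.
Qed.

Lemma pol_delta tau (i : 'I_tau.+1) :
  pol (fun j => (j == i)%:R) = (fun z => z ^+ i).
Proof. by apply/funext => z; rewrite /pol sum_natr_eqM. Qed.

Lemma pol2_delta mu nu (i : 'I_mu.+1) (j : 'I_nu.+1) :
  pol2 (fun i' j' => (i' == i)%:R * (j' == j)%:R) =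
  (fun z w => z ^+ i * w ^+ j).
Proof.
apply/funext => z; apply/funext => w; rewrite /pol2.
rewrite -(sum2_natr_eqM i j (fun i' j' => z ^+ i' * w ^+ j')).
by apply: eq_bigr => i' _; apply: eq_bigr => j' _; ring.
Qed.

Lemma Hsp_exp tau (i : 'I_tau.+1) : Hsp tau (fun z : R[i] => z ^+ i).
Proof. by rewrite -pol_delta; exact: Hsp_pol. Qed.

Lemma Hsp2_exp mu nu (i : 'I_mu.+1) (j : 'I_nu.+1) :
  Hsp2 mu nu (fun z w : R[i] => z ^+ i * w ^+ j).
Proof. by rewrite -pol2_delta; exact: Hsp2_pol2. Qed.

Lemma Hsp0 tau : Hsp tau (fun=> 0 : R[i]).
Proof. by exists (fun=> 0) => z; rewrite big1// => i _; rewrite mul0r. Qed.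

Lemma Hsp_lin tau (a : R[i]) f g : Hsp tau f -> Hsp tau g ->
  Hsp tau (fun z => a * f z + g z).
Proof. by move=> /HspP[c ->] /HspP[e ->]; rewrite pol_lin; exact: Hsp_pol. Qed.

Lemma HspZ tau (a : R[i]) f : Hsp tau f -> Hsp tau (fun z => a * f z).
Proof.
move=> /(Hsp_lin a)/(_ (Hsp0 tau)); congr Hsp.
by apply/funext => z; rewrite addr0.
Qed.

Lemma Hsp_sum tau (I : Type) (s : seq I) (f : I -> R[i] -> R[i]) :
  (forall i, Hsp tau (f i)) -> Hsp tau (fun z => \sum_(i <- s) f i z).
Proof.
move=> fH; elim: s => [|i s IHs].
  by under eq_fun do rewrite big_nil; exact: Hsp0.
under eq_fun do rewrite big_cons -[f i _]mul1r.
exact: Hsp_lin.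
Qed.

Lemma Hsp2_lin mu nu (a : R[i]) F G : Hsp2 mu nu F -> Hsp2 mu nu G ->
  Hsp2 mu nu (fun z w => a * F z w + G z w).
Proof.
by move=> /Hsp2P[c ->] /Hsp2P[e ->]; rewrite pol2_lin; exact: Hsp2_pol2.
Qed.

Lemma ip_pol tau (a b : 'I_tau.+1 -> R[i]) :
  ip tau (pol a) (pol b) = \sum_(i < tau.+1) a i * conjc (b i) / 'C(tau, i)%:R.
Proof.
have expansion : has_cintegral (leb2 R) (fun p : R * R =>
   \sum_(i < tau.+1) \sum_(j < tau.+1) a i * conjc (b j) *
     (cplx p ^+ i * conjc (cplx p) ^+ j * (dens tau (cplx p))%:C))
   (\sum_(i < tau.+1) \sum_(j < tau.+1) a i * conjc (b j) *
      ((i == j :> nat)%:R / 'C(tau, i)%:R)).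
  apply: has_cintegral_sum => i _; apply: has_cintegral_sum => j _.
  by apply: has_cintegralZ; apply: moment; rewrite -ltnS.
transitivity (\sum_(i < tau.+1) \sum_(j < tau.+1) a i * conjc (b j) *
    ((i == j :> nat)%:R / 'C(tau, i)%:R)).
  rewrite -(has_cintegralE expansion); congr cintegral; apply/funext => p /=.
  rewrite /pol rmorph_sum big_distrlr /= mulr_suml; apply: eq_bigr => i _.
  rewrite mulr_suml; apply: eq_bigr => j _.
  by rewrite rmorphM rmorphXn /=; ring.
apply: eq_bigr => i _.
rewrite -(sum_natr_eqM i (fun j => a i * conjc (b j) / 'C(tau, i)%:R)).
by apply: eq_bigr => j _; rewrite eq_sym; ring.
Qed.

Lemma ip2_pol2 mu nu (a b : 'I_mu.+1 -> 'I_nu.+1 -> R[i]) :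
  ip2 mu nu (pol2 a) (pol2 b) = \sum_(i < mu.+1) \sum_(j < nu.+1)
    a i j * conjc (b i j) / ('C(mu, i)%:R * 'C(nu, j)%:R).
Proof.
have expansion : has_cintegral (leb4 R) (fun q : R * R * R * R =>
   \sum_(i < mu.+1) \sum_(j < nu.+1) \sum_(k < mu.+1) \sum_(l < nu.+1)
     a i j * conjc (b k l) *
     (cz q ^+ i * cw q ^+ j * conjc (cz q ^+ k * cw q ^+ l)
       * (dens mu (cz q) * dens nu (cw q))%:C))
   (\sum_(i < mu.+1) \sum_(j < nu.+1) \sum_(k < mu.+1) \sum_(l < nu.+1)
     a i j * conjc (b k l) * ((i == k :> nat)%:R / 'C(mu, i)%:R *
       ((j == l :> nat)%:R / 'C(nu, j)%:R))).
  do 4 (apply: has_cintegral_sum => ? _); apply: has_cintegralZ.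
  by apply: moment2; rewrite -ltnS.
apply: etrans (etrans (has_cintegralE expansion) _).
  congr cintegral; apply/funext => q /=.
  rewrite /pol2 rmorph_sum mulr_suml mulr_suml; apply: eq_bigr => i _.
  rewrite mulr_suml mulr_suml; apply: eq_bigr => j _.
  rewrite mulr_sumr mulr_suml; apply: eq_bigr => k _.
  rewrite rmorph_sum mulr_sumr mulr_suml; apply: eq_bigr => l _.
  by rewrite !rmorphM /=; ring.
apply: eq_bigr => i _; apply: eq_bigr => j _.
rewrite -(sum2_natr_eqM i j (fun k l =>
  a i j * conjc (b k l) / ('C(mu, i)%:R * 'C(nu, j)%:R))).
apply: eq_bigr => k _; apply: eq_bigr => l _.
by rewrite invfM (eq_sym (i : nat)) (eq_sym (j : nat)); ring.
Qed.

Lemma ip_pol_exp tau (c : 'I_tau.+1 -> R[i]) (i : 'I_tau.+1) :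
  ip tau (pol c) (fun z => z ^+ i) = c i / 'C(tau, i)%:R.
Proof.
rewrite -pol_delta ip_pol -(sum_natr_eqM i (fun j => c j / 'C(tau, j)%:R)).
by apply: eq_bigr => j _; rewrite conjc_nat; ring.
Qed.

Lemma ip2_exp_pol2 mu nu (c : 'I_mu.+1 -> 'I_nu.+1 -> R[i])
    (i : 'I_mu.+1) (j : 'I_nu.+1) :
  ip2 mu nu (fun z w => z ^+ i * w ^+ j) (pol2 c) =
  conjc (c i j) / ('C(mu, i)%:R * 'C(nu, j)%:R).
Proof.
rewrite -pol2_delta ip2_pol2 -(sum2_natr_eqM i j (fun i' j' =>
  conjc (c i' j') / ('C(mu, i')%:R * 'C(nu, j')%:R))).
by apply: eq_bigr => i' _; apply: eq_bigr => j' _; ring.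
Qed.

Lemma pol_inj tau (c e : 'I_tau.+1 -> R[i]) : pol c = pol e -> c =1 e.
Proof.
move=> ce i; have C0 : 'C(tau, i)%:R^-1 != 0 :> R[i].
  by rewrite invr_eq0 natr_bin_neq0 // -ltnS.
by apply: (mulIf C0); rewrite -!ip_pol_exp ce.
Qed.

Lemma coefs_pol tau (c : 'I_tau.+1 -> R[i]) : coefs tau (pol c) =1 c.
Proof.
rewrite /coefs; case: xgetP => [d _ /= dP|/(_ (finfun c))].
  by apply/pol_inj/funext => z; rewrite dP.
by case=> /= z; apply: eq_bigr => i _; rewrite ffunE.
Qed.

Lemma ip_linl tau a f g h : Hsp tau f -> Hsp tau g -> Hsp tau h ->
  ip tau (fun z => a * f z + g z) h = a * ip tau f h + ip tau g h.
Proof.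
move=> /HspP[c ->] /HspP[d ->] /HspP[e ->]; rewrite pol_lin !ip_pol.
by rewrite mulr_sumr -big_split; apply: eq_bigr => i _ /=; ring.
Qed.

Lemma ip_linr tau a f g h : Hsp tau f -> Hsp tau g -> Hsp tau h ->
  ip tau h (fun z => a * f z + g z) = conjc a * ip tau h f + ip tau h g.
Proof.
move=> /HspP[c ->] /HspP[d ->] /HspP[e ->]; rewrite pol_lin !ip_pol.
rewrite mulr_sumr -big_split; apply: eq_bigr => i _ /=.
by rewrite rmorphD rmorphM /=; ring.
Qed.

Lemma ip2_linl mu nu a F G H : Hsp2 mu nu F -> Hsp2 mu nu G -> Hsp2 mu nu H ->
  ip2 mu nu (fun z w => a * F z w + G z w) H =
  a * ip2 mu nu F H + ip2 mu nu G H.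
Proof.
move=> /Hsp2P[c ->] /Hsp2P[d ->] /Hsp2P[e ->]; rewrite pol2_lin !ip2_pol2.
rewrite mulr_sumr -big_split; apply: eq_bigr => i _ /=.
by rewrite mulr_sumr -big_split; apply: eq_bigr => j _ /=; ring.
Qed.

Lemma ip2_linr mu nu a F G H : Hsp2 mu nu F -> Hsp2 mu nu G -> Hsp2 mu nu H ->
  ip2 mu nu H (fun z w => a * F z w + G z w) =
  conjc a * ip2 mu nu H F + ip2 mu nu H G.
Proof.
move=> /Hsp2P[c ->] /Hsp2P[d ->] /Hsp2P[e ->]; rewrite pol2_lin !ip2_pol2.
rewrite mulr_sumr -big_split; apply: eq_bigr => i _ /=.
rewrite mulr_sumr -big_split; apply: eq_bigr => j _ /=.
by rewrite rmorphD rmorphM /=; ring.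
Qed.

Lemma ipZl tau a f g : Hsp tau f -> Hsp tau g ->
  ip tau (fun z => a * f z) g = a * ip tau f g.
Proof.
move=> /HspP[c ->] /HspP[e ->].
have -> : (fun z => a * pol c z) = pol (fun i => a * c i).
  apply/funext => z; rewrite /pol mulr_sumr.
  by apply: eq_bigr => i _; rewrite mulrA.
by rewrite !ip_pol mulr_sumr; apply: eq_bigr => i _; rewrite !mulrA.
Qed.

Lemma ip_extl tau f g : Hsp tau f -> Hsp tau g ->
  (forall h, Hsp tau h -> ip tau f h = ip tau g h) -> f = g.
Proof.
move=> /HspP[c ->] /HspP[e ->] ce; congr pol; apply/funext => i.
have C0 : 'C(tau, i)%:R^-1 != 0 :> R[i].
  by rewrite invr_eq0 natr_bin_neq0 // -ltnS.
by apply: (mulIf C0); rewrite -!ip_pol_exp; exact/ce/Hsp_exp.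
Qed.

Lemma ip2_extr mu nu F G : Hsp2 mu nu F -> Hsp2 mu nu G ->
  (forall H, Hsp2 mu nu H -> ip2 mu nu H F = ip2 mu nu H G) -> F = G.
Proof.
move=> /Hsp2P[c ->] /Hsp2P[e ->] ce; congr pol2.
apply/funext => i; apply/funext => j; apply: (can_inj (@conjcK R)).
have C0 : ('C(mu, i)%:R * 'C(nu, j)%:R)^-1 != 0 :> R[i].
  by rewrite invr_eq0 mulf_neq0 // natr_bin_neq0 // -ltnS.
by apply: (mulIf C0); rewrite -!ip2_exp_pol2; exact/ce/Hsp2_exp.
Qed.

End PolynomialSpaces.

Section TensorDecomposition.
Context {R : realType}.
Implicit Types F : R[i] -> R[i] -> R[i].

Definition tens nu (f : 'I_nu.+1 -> R[i] -> R[i]) (z w : R[i]) : R[i] :=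
  \sum_(l < nu.+1) f l z * w ^+ l.

Definition wcoef nu (l : 'I_nu.+1) F : R[i] -> R[i] :=
  fun z => coefs nu (F z) l.

Lemma wcoef_tens nu (f : 'I_nu.+1 -> R[i] -> R[i]) l : wcoef l (tens f) = f l.
Proof. by apply/funext => z; rewrite /wcoef (coefs_pol (f ^~ z)). Qed.

Lemma pol2_tens mu nu (c : 'I_mu.+1 -> 'I_nu.+1 -> R[i]) :
  pol2 c = tens (fun l => pol (c ^~ l)).
Proof.
apply/funext => z; apply/funext => w; rewrite /pol2 exchange_big /=.
by apply: eq_bigr => l _; rewrite mulr_suml.
Qed.

Lemma Hsp_wcoef mu nu F (l : 'I_nu.+1) : Hsp2 mu nu F -> Hsp mu (wcoef l F).
Proof.
by move=> /Hsp2P[c ->]; rewrite pol2_tens wcoef_tens; exact: Hsp_pol.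
Qed.

Lemma tens_wcoef mu nu F : Hsp2 mu nu F -> F = tens (wcoef (nu := nu) ^~ F).
Proof.
move=> /Hsp2P[c ->]; rewrite {1}pol2_tens; congr tens; apply/funext => l.
by rewrite pol2_tens wcoef_tens.
Qed.

Lemma tens_pol mu nu (f : 'I_nu.+1 -> R[i] -> R[i]) :
  (forall l, Hsp mu (f l)) ->
  exists c : 'I_mu.+1 -> 'I_nu.+1 -> R[i], f = fun l => pol (c ^~ l).
Proof.
move=> fH; have /choice[c cE] : forall l, exists c, f l = pol (tau := mu) c.
  by move=> l; exact: HspP.
by exists (fun i l => c l i); apply/funext.
Qed.

Lemma Hsp2_tens mu nu (f : 'I_nu.+1 -> R[i] -> R[i]) :
  (forall l, Hsp mu (f l)) -> Hsp2 mu nu (tens f).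
Proof. by move=> /tens_pol[c ->]; rewrite -pol2_tens; exact: Hsp2_pol2. Qed.

Lemma ip2_tens mu nu (f g : 'I_nu.+1 -> R[i] -> R[i]) :
  (forall l, Hsp mu (f l)) -> (forall l, Hsp mu (g l)) ->
  ip2 mu nu (tens f) (tens g) =
  \sum_(l < nu.+1) 'C(nu, l)%:R^-1 * ip mu (f l) (g l).
Proof.
move=> /tens_pol[c ->] /tens_pol[e ->].
rewrite -!pol2_tens ip2_pol2 exchange_big; apply: eq_bigr => l _ /=.
rewrite ip_pol mulr_sumr; apply: eq_bigr => i _.
by rewrite invfM; ring.
Qed.

End TensorDecomposition.

(** * Operators *)

Section Operators.
Context {R : realType}.
Implicit Types (f g : R[i] -> R[i]) (F G : R[i] -> R[i] -> R[i]) (A : op R).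

Lemma isop0 tau A : isop tau A -> A (fun=> 0) = fun=> 0.
Proof.
move=> [_ /(_ (-1) _ _ (Hsp0 tau) (Hsp0 tau))].
under eq_fun do rewrite mulr0 addr0.
by move=> ->; apply/funext => z; rewrite mulN1r addNr.
Qed.

Lemma isop_sum tau A (I : Type) (s : seq I) (c : I -> R[i])
    (f : I -> R[i] -> R[i]) : isop tau A -> (forall i, Hsp tau (f i)) ->
  A (fun z => \sum_(i <- s) c i * f i z) =
  fun z => \sum_(i <- s) c i * A (f i) z.
Proof.
move=> Aop fH; elim: s => [|i s IHs].
  under eq_fun do rewrite big_nil; rewrite (isop0 Aop).
  by under [RHS]eq_fun do rewrite big_nil.
under eq_fun do rewrite big_cons; under [RHS]eq_fun do rewrite big_cons.
rewrite Aop.2 ?IHs//; apply: Hsp_sum => j; exact: HspZ.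
Qed.

Lemma isopZ tau A (r : R[i]) : isop tau A -> isop tau (fun f z => r * A f z).
Proof.
move=> [AH Alin]; split=> [f fH|a f g fH gH]; first exact/HspZ/AH.
by rewrite Alin//; apply/funext => z; ring.
Qed.

Lemma ip_op_pol tau A (c e : 'I_tau.+1 -> R[i]) : isop tau A ->
  ip tau (A (pol c)) (pol e) = \sum_(i < tau.+1) \sum_(j < tau.+1)
    c i * conjc (e j) * ip tau (A (fun z => z ^+ i)) (fun z => z ^+ j).
Proof.
move=> Aop; have /choice[M ME] : forall i : 'I_tau.+1,
    exists d : 'I_tau.+1 -> R[i], A (fun z => z ^+ i) = pol d.
  by move=> i; apply/HspP/Aop.1/Hsp_exp.
have -> : A (pol c) = pol (fun j => \sum_i c i * M i j).
  rewrite [pol c](_ : _ = fun z => \sum_(i < tau.+1) c i * z ^+ i)//.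
  rewrite (isop_sum _ _ Aop (fun i => Hsp_exp i)); apply/funext => z.
  rewrite /pol; under [RHS]eq_bigr do rewrite mulr_suml.
  rewrite exchange_big /=; apply: eq_bigr => i _; rewrite ME /pol mulr_sumr.
  by apply: eq_bigr => j _; rewrite mulrA.
rewrite ip_pol exchange_big /=; apply: eq_bigr => j _; rewrite !mulr_suml.
by apply: eq_bigr => i _; rewrite ME ip_pol_exp; ring.
Qed.

Lemma ip_op_pol_disjoint tau A (c e : 'I_tau.+1 -> R[i]) : isop tau A ->
  (forall i j, i != j -> c i * conjc (e j) = 0) ->
  ip tau (A (pol c)) (pol e) = \sum_(i < tau.+1)
    c i * conjc (e i) * ip tau (A (fun z => z ^+ i)) (fun z => z ^+ i).
Proof.
move=> Aop ce0; rewrite ip_op_pol//; apply: eq_bigr => i _.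
rewrite (bigD1 i)//= big1 ?addr0// => j; rewrite eq_sym => /ce0->.
by rewrite mul0r.
Qed.

Lemma optr_ip tau A : isop tau A -> optr tau A =
  \sum_(i < tau.+1) 'C(tau, i)%:R *
    ip tau (A (fun z => z ^+ i)) (fun z => z ^+ i).
Proof.
move=> Aop; apply: eq_bigr => i _.
have [c ->] := HspP (Aop.1 _ (Hsp_exp i)).
by rewrite coefs_pol ip_pol_exp mulrC divfK// natr_bin_neq0// -ltnS.
Qed.

Lemma optrZ tau A (r : R[i]) : isop tau A ->
  optr tau (fun f z => r * A f z) = r * optr tau A.
Proof.
move=> Aop; rewrite !optr_ip ?mulr_sumr//; last exact: isopZ.
apply: eq_bigr => i _; rewrite ipZl; [ring|exact/Aop.1/Hsp_exp|exact: Hsp_exp].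
Qed.

Lemma tensorI_tens mu nu A (f : 'I_nu.+1 -> R[i] -> R[i]) :
  isop mu A -> (forall l, Hsp mu (f l)) ->
  tensorI A (tens f) = tens (fun l => A (f l)).
Proof.
move=> Aop fH; apply/funext => z; apply/funext => w; rewrite /tensorI /tens.
under [X in A X]eq_fun do under eq_bigr do rewrite mulrC.
by rewrite (isop_sum _ _ Aop fH); apply: eq_bigr => l _; rewrite mulrC.
Qed.

Lemma Hsp_slice mu nu F w : Hsp2 mu nu F -> Hsp mu (F ^~ w).
Proof.
move=> [c Fc]; exists (fun i => \sum_(j < nu.+1) c i j * w ^+ j) => z.
rewrite Fc; apply: eq_bigr => i _; rewrite mulr_suml.
by apply: eq_bigr => j _; ring.
Qed.

Lemma tensorI_lin mu nu A (a : R[i]) F G :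
  isop mu A -> Hsp2 mu nu F -> Hsp2 mu nu G ->
  tensorI A (fun z w => a * F z w + G z w) =
  fun z w => a * tensorI A F z w + tensorI A G z w.
Proof.
move=> [_ Alin] FH GH; apply/funext => z; apply/funext => w; rewrite /tensorI.
rewrite (Alin a (F ^~ w) (G ^~ w))//; first exact: Hsp_slice FH.
exact: Hsp_slice GH.
Qed.

Lemma Hsp2_tensorI mu nu A F :
  isop mu A -> Hsp2 mu nu F -> Hsp2 mu nu (tensorI A F).
Proof.
move=> Aop FH; have FlH l := Hsp_wcoef (nu := nu) l FH.
rewrite (tens_wcoef FH) (tensorI_tens Aop)//.
by apply: Hsp2_tens => l; exact: Aop.1.
Qed.

Lemma ip2_tensorI mu nu A F G : isop mu A -> Hsp2 mu nu F -> Hsp2 mu nu G ->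
  ip2 mu nu (tensorI A F) G =
  \sum_(l < nu.+1) 'C(nu, l)%:R^-1 * ip mu (A (wcoef l F)) (wcoef l G).
Proof.
move=> Aop FH GH; have FlH l := Hsp_wcoef (nu := nu) l FH.
rewrite {1}(tens_wcoef FH) {1}(tens_wcoef GH) (tensorI_tens Aop)//.
by rewrite ip2_tens// => l; [exact: Aop.1|exact: Hsp_wcoef GH].
Qed.

Lemma completely_positive_kraus m n L (V : 'I_L -> op R) (c : 'I_L -> R[i])
    (T : op R -> op R) :
  (forall l, 0 <= c l) -> (forall l f, Hsp n f -> Hsp m (V l f)) ->
  (forall A, isop m A -> isop n (T A)) ->
  (forall A f g, isop m A -> Hsp n f -> Hsp n g ->
    ip n (T A g) f = \sum_(l < L) c l * ip m (A (V l g)) (V l f)) ->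
  completely_positive m n T.
Proof.
move=> c0 VH Top TE; split=> // N A Aop Apos f fH.
under eq_bigr do under eq_bigr do rewrite TE//.
under eq_bigr do rewrite exchange_big /=.
rewrite exchange_big /=; apply: sumr_ge0 => l _.
under eq_bigr do rewrite -mulr_sumr; rewrite -mulr_sumr.
by apply: mulr_ge0 => //; apply: (Apos (fun i => V l (f i))) => i; exact: VH.
Qed.

Lemma completely_positiveZ m n (r : R[i]) (T : op R -> op R) :
  0 <= r -> completely_positive m n T ->
  completely_positive m n (fun A f z => r * T A f z).
Proof.
move=> r0 [Top Tpos]; split=> [A /Top|N A Aop Apos f fH]; first exact: isopZ.
have -> : \sum_(i < N) \sum_(j < N)
      ip n (fun z => r * T (A i j) (f j) z) (f i) =
    r * \sum_(i < N) \sum_(j < N) ip n (T (A i j) (f j)) (f i).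
  rewrite mulr_sumr; apply: eq_bigr => i _.
  rewrite mulr_sumr; apply: eq_bigr => j _.
  by rewrite ipZl//; exact/(Top _ (Aop i j)).1/fH.
by rewrite mulr_ge0//; exact: Tpos.
Qed.

End Operators.

Section Compression.
Context {R : realType}.
Variables (mu nu n : nat).
Variables (P : (R[i] -> R[i] -> R[i]) -> (R[i] -> R[i]))
  (Pstar : (R[i] -> R[i]) -> (R[i] -> R[i] -> R[i])).
Hypothesis adjP : is_adjoint mu nu n P Pstar.
Hypothesis HspP2 : forall F, Hsp2 mu nu F -> Hsp n (P F).
Implicit Types (f g : R[i] -> R[i]) (F G : R[i] -> R[i] -> R[i]) (A : op R).

Definition compress A : op R := fun g => P (tensorI A (Pstar g)).

Lemma adjointable_lin (a : R[i]) F G : Hsp2 mu nu F -> Hsp2 mu nu G ->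
  P (fun z w => a * F z w + G z w) = fun xi => a * P F xi + P G xi.
Proof.
move=> FH GH; have [PstarH PE] := adjP; have FGH := Hsp2_lin a FH GH.
have [PFH PGH] := (HspP2 FH, HspP2 GH).
apply: (ip_extl (tau := n)); [exact: HspP2|exact: Hsp_lin|move=> g gH].
by rewrite PE// ip_linl ?ip2_linl ?PE//; exact: PstarH.
Qed.

Lemma adjoint_lin (a : R[i]) f g : Hsp n f -> Hsp n g ->
  Pstar (fun xi => a * f xi + g xi) = fun z w => a * Pstar f z w + Pstar g z w.
Proof.
move=> fH gH; have [PstarH PE] := adjP; have fgH := Hsp_lin a fH gH.
have [PfH PgH] := (PstarH f fH, PstarH g gH).
apply: (ip2_extr (mu := mu) (nu := nu)).
- exact: PstarH.
- exact: Hsp2_lin.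
- by move=> F FH; rewrite -PE// ip2_linr// ip_linr -?PE//; exact: HspP2.
Qed.

Lemma isop_compress A : isop mu A -> isop n (compress A).
Proof.
move=> Aop; have [PstarH _] := adjP; split=> [f fH|a f g fH gH].
  exact/HspP2/Hsp2_tensorI/PstarH.
have [PfH PgH] := (PstarH f fH, PstarH g gH).
rewrite /compress adjoint_lin// (tensorI_lin (mu := mu) (nu := nu))//.
by rewrite adjointable_lin//; exact: Hsp2_tensorI.
Qed.

Lemma ip_compress A f g : isop mu A -> Hsp n f -> Hsp n g ->
  ip n (compress A g) f = \sum_(l < nu.+1)
    'C(nu, l)%:R^-1 * ip mu (A (wcoef l (Pstar g))) (wcoef l (Pstar f)).
Proof.
move=> Aop fH gH; have [PstarH PE] := adjP.
have [PfH PgH] := (PstarH f fH, PstarH g gH).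
by rewrite PE ?ip2_tensorI//; exact: Hsp2_tensorI.
Qed.

(* The Kraus operators read off the coefficient of w^l in [Pstar g]. *)
Lemma compress_completely_positive : completely_positive mu n compress.
Proof.
apply: (completely_positive_kraus (V := fun l g => wcoef l (Pstar g))
  (c := fun l : 'I_nu.+1 => 'C(nu, l)%:R^-1)).
- by move=> l; rewrite invr_ge0.
- by move=> l f fH; exact/Hsp_wcoef/adjP.1.
- exact: isop_compress.
- exact: ip_compress.
Qed.

End Compression.

(** * The projection onto a component *)

Section Constant.
Context {R : realType}.

Lemma poch_natN (N k : nat) : poch (- N%:R : R) k = (-1) ^+ k * (N ^_ k)%:R.
Proof.
elim: k => [|k IHk]; first by rewrite /poch big_ord0 mul1r.
rewrite /poch big_ord_recr /= -/(poch _ k) IHk ffactnSr natrM exprS.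
have [kN|Nk] := leqP k N; first by rewrite natrB//; ring.
by rewrite ffact_small// !(mulr0, mul0r).
Qed.

Lemma poch_natD2 (m k : nat) : poch (m%:R + 2 : R) k = ((m + k).+1 ^_ k)%:R.
Proof.
elim: k => [|k IHk]; first by rewrite /poch big_ord0.
rewrite /poch big_ord_recr /= -/(poch _ k) IHk addnS ffactSS natrM.
by rewrite -[(m + k).+2]addn2 !natrD; ring.
Qed.

Lemma sqr_Cconst (a b k : nat) :
  (Cconst R (k + a) (k + b) k)%:C ^+ 2 =
  'C(k + a, k)%:R * 'C(k + b, k)%:R / 'C(a + k + b.+1, k)%:R :> R[i].
Proof.
have quotientE : poch (- (k + b)%:R) k * poch (- (k + a)%:R) k /
    (k`!%:R * poch ((k + a + (k + b) - 2 * k)%N%:R + 2) k) =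
    'C(k + a, k)%:R * 'C(k + b, k)%:R / 'C(a + k + b.+1, k)%:R :> R.
  rewrite !poch_natN (_ : k + a + (k + b) - 2 * k = a + b)%N; last by lia.
  rewrite poch_natD2 (_ : (a + b + k).+1 = a + k + b.+1)%N; last by lia.
  have C0 : 'C(a + k + b.+1, k)%:R != 0 :> R by apply: natr_bin_neq0; lia.
  have k0 : k`!%:R != 0 :> R by rewrite pnatr_eq0 -lt0n fact_gt0.
  rewrite -!bin_ffact !natrM.
  have sign2 := sqrr_sign R k; move: ((-1) ^+ k) sign2 => sign sign2.
  transitivity (sign ^+ 2 * 'C(k + a, k)%:R * 'C(k + b, k)%:R /
    'C(a + k + b.+1, k)%:R); first by field; rewrite C0 k0.
  by rewrite sign2 mul1r.
rewrite -rmorphXn /= /Cconst quotientE sqr_sqrtr ?divr_ge0 ?mulr_ge0//.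
by rewrite rmorphM fmorphV rmorphM !rmorph_nat.
Qed.

End Constant.

Section Projection.
Context {R : realType}.
Variables a b k : nat.
Local Notation mu := (k + a)%N.
Local Notation nu := (k + b)%N.
Local Notation n := (a + b)%N.
Local Notation pcoef := (@proj_coef R[i] a b k (Cconst R mu nu k)%:C).
Local Notation acoef := (@adj_coef R[i] a b k (Cconst R mu nu k)%:C).

Lemma Pk_pol2 (c : 'I_mu.+1 -> 'I_nu.+1 -> R[i]) :
  Pk mu nu k (pol2 c) = fun xi =>
    \sum_(i < mu.+1) \sum_(j < nu.+1) c i j * (pcoef i j * xi ^+ (i + j - k)).
Proof.
apply/funext => xi.
pose G z w := (z - w) ^+ k * (1 + conjc xi * z) ^+ a * (1 + conjc xi * w) ^+ b.
have GE : G = pol2 (mu := mu) (nu := nu)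
    (fun i j => gcoef R[i] a b k i j * conjc xi ^+ (i + j - k)).
  by apply/funext => z; apply/funext => w; rewrite /G gcoef_expand.
have Gconj z w : conjc (G z w) =
    (conjc z - conjc w) ^+ k * (1 + xi * conjc z) ^+ a *
      (1 + xi * conjc w) ^+ b.
  by rewrite /G !rmorphM !rmorphXn rmorphB !rmorphD rmorph1 !rmorphM /= conjcK.
have -> : Pk mu nu k (pol2 c) xi = (Cconst R mu nu k)%:C * ip2 mu nu (pol2 c) G.
  rewrite /Pk /Jk /ip2; congr (_ * cintegral _ _); apply/funext => q.
  by rewrite !addKn Gconj !mulrA.
rewrite GE ip2_pol2 mulr_sumr; apply: eq_bigr => i _.
rewrite mulr_sumr; apply: eq_bigr => j _.
by rewrite rmorphM rmorphXn /= conjcK rmorph_gcoef /proj_coef; ring.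
Qed.

Lemma Pk_exp (i : 'I_mu.+1) (j : 'I_nu.+1) :
  Pk mu nu k (fun z w => z ^+ i * w ^+ j) =
  fun xi => pcoef i j * xi ^+ (i + j - k).
Proof.
rewrite -pol2_delta Pk_pol2; apply/funext => xi.
rewrite -(sum2_natr_eqM i j (fun i' j' => pcoef i' j' * xi ^+ (i' + j' - k))).
by apply: eq_bigr => i' _; apply: eq_bigr => j' _; rewrite mulrA.
Qed.

Lemma gcoef_out (K : comNzRingType) i j :
  ~~ (k <= i + j <= n + k)%N -> gcoef K a b k i j = 0.
Proof. by move=> out; apply: gcoef_eq0; lia. Qed.

Lemma Hsp_Pk (F : R[i] -> R[i] -> R[i]) : Hsp2 mu nu F -> Hsp n (Pk mu nu k F).
Proof.
move=> /Hsp2P[c ->]; rewrite Pk_pol2.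
apply: Hsp_sum => i; apply: Hsp_sum => j; apply: HspZ.
have [/andP[kij ijn]|/gcoef_out g0] := boolP (k <= i + j <= n + k)%N.
  have dn : (i + j - k < n.+1)%N by lia.
  exact/HspZ/(Hsp_exp (Ordinal dn)).
by under eq_fun do rewrite /proj_coef g0 mulr0 !mul0r; exact: Hsp0.
Qed.

Lemma conjc_natr_adj_coef (N i j : nat) :
  conjc (N%:R * acoef i j) = N%:R * acoef i j.
Proof.
rewrite rmorphM rmorph_nat /adj_coef; congr (_ * _).
rewrite rmorphM rmorphM fmorphV rmorph_nat.
by congr (_ * _ / _); [exact: conjc_real|exact: rmorph_gcoef].
Qed.

Lemma ip_Pk_exp (i : 'I_mu.+1) (j : 'I_nu.+1) (m : 'I_n.+1) :
  ip n (Pk mu nu k (fun z w => z ^+ i * w ^+ j)) (fun xi => xi ^+ m) =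
  (i + j == m + k)%N%:R * acoef i j / ('C(mu, i)%:R * 'C(nu, j)%:R).
Proof.
rewrite Pk_exp /proj_coef /adj_coef.
have [/andP[kij ijn]|/gcoef_out->] := boolP (k <= i + j <= n + k)%N; last first.
  under eq_fun => xi do rewrite !(mulr0, mul0r) -(mul0r (xi ^+ m)).
  by rewrite ipZl ?(mulr0, mul0r)//; exact: Hsp_exp.
have dn : (i + j - k < n.+1)%N by lia.
rewrite ipZl; [|exact: (Hsp_exp (Ordinal dn))|exact: Hsp_exp].
rewrite -(pol_delta (Ordinal dn)) ip_pol_exp -val_eqE /=.
have -> : (i + j == m + k)%N = (m == i + j - k :> nat)%N by lia.
by case: eqP => [->|_]; rewrite ?mul0r ?mulr0 ?mul1r// mulrAC.
Qed.

Lemma sum_bin_adj_coef (i : 'I_mu.+1) (j : 'I_nu.+1) :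
  \sum_(m < n.+1) (i + j == m + k)%N%:R * 'C(n, m)%:R * acoef i j =
  'C(mu, i)%:R * 'C(nu, j)%:R * pcoef i j.
Proof.
rewrite /proj_coef /adj_coef.
have [/andP[kij ijn]|/gcoef_out->] := boolP (k <= i + j <= n + k)%N; last first.
  by rewrite !(mulr0, mul0r) big1// => m _; rewrite mulr0.
have dn : (i + j - k < n.+1)%N by lia.
have Ci := natr_bin_neq0 R[i] (ltnSE (ltn_ord i)).
have Cj := natr_bin_neq0 R[i] (ltnSE (ltn_ord j)).
have Cd := natr_bin_neq0 R[i] (ltnSE dn).
rewrite [RHS]mulrC (divfK (mulf_neq0 Ci Cj)).
pose u (m : 'I_n.+1) := 'C(n, m)%:R * acoef i j.
transitivity (u (Ordinal dn)); last by rewrite /u /adj_coef mulrC divfK.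
rewrite -(sum_natr_eqM (Ordinal dn) u); apply: eq_bigr => m _.
rewrite -val_eqE /=.
have -> : (i + j == m + k)%N = (m == i + j - k :> nat)%N by lia.
by rewrite /u [RHS]mulrA.
Qed.

Variable Pstar : (R[i] -> R[i]) -> (R[i] -> R[i] -> R[i]).
Hypothesis adjP : is_adjoint mu nu n (@Pk R mu nu k) Pstar.

Lemma adjoint_Pk_exp (m : 'I_n.+1) : Pstar (fun xi => xi ^+ m) =
  tens (fun l : 'I_nu.+1 => pol (fun i : 'I_mu.+1 =>
    (i + l == m + k)%N%:R * acoef i l)).
Proof.
have [e eE] := Hsp2P (adjP.1 _ (Hsp_exp m)).
rewrite eE -pol2_tens; congr pol2; apply/funext => i; apply/funext => j.
have C0 : ('C(mu, i)%:R * 'C(nu, j)%:R)^-1 != 0 :> R[i].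
  by rewrite invr_eq0 mulf_neq0 // natr_bin_neq0 // -ltnS.
apply: (can_inj (@conjcK R)); apply: (mulIf C0).
rewrite conjc_natr_adj_coef -ip_Pk_exp -ip2_exp_pol2 -eE.
by rewrite -adjP.2//; [exact: Hsp2_exp|exact: Hsp_exp].
Qed.

Lemma optr_compress_Pk A : isop mu A ->
  optr n (compress (@Pk R mu nu k) Pstar A) = n.+1%:R / mu.+1%:R * optr mu A.
Proof.
move=> Aop; rewrite !optr_ip//; last exact: isop_compress adjP Hsp_Pk _ Aop.
under eq_bigr do rewrite (ip_compress adjP Aop (Hsp_exp _) (Hsp_exp _)).
pose M (i : 'I_mu.+1) := ip mu (A (fun z => z ^+ i)) (fun z => z ^+ i).
transitivity (\sum_(m < n.+1) \sum_(l < nu.+1) \sum_(i < mu.+1)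
    ((i + l == m + k)%N%:R * 'C(n, m)%:R * acoef i l) *
    (acoef i l / 'C(nu, l)%:R * M i)).
  apply: eq_bigr => m _; rewrite mulr_sumr; apply: eq_bigr => l _.
  rewrite adjoint_Pk_exp wcoef_tens ip_op_pol_disjoint// => [|i j ij].
    rewrite !mulr_sumr; apply: eq_bigr => i _.
    rewrite conjc_natr_adj_coef -/(M i).
    by case: (_ == _); rewrite ?mul1r ?(mul0r, mulr0)//; ring.
  case: eqP => [il|_]; last by rewrite !mul0r.
  case: eqP => [jl|_]; last by rewrite mul0r rmorph0 mulr0.
  by case/eqP: ij; apply/val_inj => /=; lia.
rewrite exchange_big; under eq_bigr do rewrite exchange_big.
rewrite exchange_big mulr_sumr.
apply: eq_bigr => i _ /=.
rewrite -(sum_proj_adj_coef (sqr_Cconst a b k) (ltnSE (ltn_ord i))) mulr_suml.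
apply: eq_bigr => l _; rewrite -mulr_suml sum_bin_adj_coef -/(M i).
have C0 : 'C(nu, l)%:R != 0 :> R[i] by rewrite natr_bin_neq0 // -ltnS.
by field.
Qed.

End Projection.

Theorem mainTheorem2 (R : realType) (mu nu k : nat)
  (hk : (k <= mu)%N) (hmunu : (mu < nu)%N)
  (Pstar : (R[i] -> R[i]) -> (R[i] -> R[i] -> R[i]))
  (hPstar : is_adjoint mu nu (mu + nu - 2 * k) (@Pk R mu nu k) Pstar) :
  let n := (mu + nu - 2 * k)%N in
  let T := fun (A : op R) (g : R[i] -> R[i]) => Pk mu nu k (tensorI A (Pstar g)) in
  let That := fun (A : op R) (g : R[i] -> R[i]) (xi : R[i]) =>
                (mu.+1%:R / n.+1%:R : R)%:C * T A g xi in
  completely_positive mu n T /\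
  completely_positive mu n That /\ trace_preserving mu n That.
Proof.
have [a muE] : {a | mu = (k + a)%N} by exists (mu - k)%N; lia.
have [b nuE] : {b | nu = (k + b)%N} by exists (nu - k)%N; lia.
subst mu nu; have nE : (k + a + (k + b) - 2 * k = a + b)%N by lia.
rewrite nE in hPstar * => n T That.
have Tcp : completely_positive (k + a) n T.
  exact: compress_completely_positive hPstar (@Hsp_Pk R a b k).
split=> //; split.
  by apply: completely_positiveZ Tcp; rewrite ler0c divr_ge0.
move=> A Aop; rewrite (optrZ _ (Tcp.1 A Aop)).
rewrite (optr_compress_Pk hPstar Aop) mulrA.
by rewrite rmorphM fmorphV !rmorph_nat mulrA divfK ?divff ?pnatr_eq0// mul1r.
Qed.
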